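(* Assume (A1)–(A4) (stated in the context) and let $T>0$. Let $k$ be the minimizer of the primal problem (P) and $(k_1^*,k_2^* )\in\mathcal L^f_g\times\mathcal L^g_f$ the minimizer of the dual problem (D), both stated in the context. Let $\Phi$ be the convex solution of the Monge–Ampère equation $$k_y(\nabla\Phi(x))\det(D^2\Phi(x))=k_x(x),$$ and define $$\mathscr T_t(x)=\frac{T-t}{T}x+\frac tT\nabla\Phi(x),\qquad \Xi_t(x)=\frac1T\left(\nabla\Phi(\mathscr T_t^{-1}(x))-\mathscr T_t^{-1}(x)\right),$$ $$\rho_t(x)=\frac1T\left(-\frac{k_1^*(\mathscr T_t^{-1}(x))}{1-\frac tTk_1^*(\mathscr T_t^{-1}(x))}+\frac{k_2^*(\nabla\Phi(\mathscr T_t^{-1}(x)))}{1-\frac tTk_2^*(\nabla\Phi(\mathscr T_t^{-1}(x)))}\right).$$ Then there exists a flow $(\mu_t)_{t\in[0,T]}$ solving the continuity equation $$\partial_t\mu_t+\nabla_x\cdot(\Xi_t\mu_t)=\rho_t\mu_t$$ with initial and terminal conditions $\mu_0=f\mathcal L$ and $\mu_T=g\mathcal L$.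
   Context: Let $d\in\mathbb N$ and let $\mathcal L$ be Lebesgue measure. For $c>0$, $\mathcal M^\infty_{\mathcal L,c}$ is the set of measures $\mu=f\mathcal L$ on $\mathbb R^d$ such that $f\in L^\infty(\mathbb R^d)$, $f$ has compact support, and $f\ge c$ a.e. on its support. Write $\Omega_f=\operatorname{supp} f$, $\Omega_g=\operatorname{supp} g$, $\Omega=\Omega_f\times\Omega_g$, and $|\cdot|$ for Lebesgue measure of a set. $C:\mathbb R^d\times\mathbb R^d\to[0,\infty)$ is a cost function and $\delta>0$. Assumptions: (A1) $f\mathcal L,g\mathcal L\in\mathcal M^\infty_{\mathcal L,c}$; (A2) $\Omega_f,\Omega_g$ are convex with $C^{1,1}$ boundary; (A3) $\delta\max\{|\Omega_f|,|\Omega_g|\}\le c$; (A4) $C$ is locally Hölder continuous. For $\theta>0$, $L^2_\theta(A)=\{u\in L^2(A): u\ge\theta\text{ a.e.}\}$. Marginal densities: $k_x(x)=\int_{\Omega_g}k(x,y)\,dy$, $k_y(y)=\int_{\Omega_f}k(x,y)\,dx$. Pearson divergence: $F(u\mid v)=\int_{\operatorname{supp}v}(\frac uv-1)^2v\,dx$. Further $F^*_\theta(u^*\mid v)=\sup_{u\in L^2_\theta(\operatorname{supp}v)}\{\int uu^*\,dx-F(u\mid v)\}$ and $\bar C^*_\delta(w^* )=\sup_{k\in L^2_\delta(\Omega)}\{\int_\Omega kw^*-\int_\Omega Ck-\frac12\|k\|_{L^2}^2\}$. Primal problem (P): minimize $\int_\Omega Ck\,dx\,dy+\frac12\|k\|_{L^2}^2+\frac12F(k_x\mid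 f)+\frac12F(k_y\mid g)$ over $k\in L^2_\delta(\Omega)$. Dual problem (D): minimize $\bar C^*_\delta(k_1^*+k_2^* )+\frac12F^*_{\delta|\Omega_g|}(-2k_1^*\mid f)+\frac12F^*_{\delta|\Omega_f|}(-2k_2^*\mid g)$ over $k_1^*\in L^2(\Omega_f)$, $k_2^*\in L^2(\Omega_g)$, where $(k_1^*+k_2^* )(x,y)=k_1^*(x)+k_2^*(y)$. $\mathcal L^f_g=\{h\in L^2(\Omega_f):h\le1-\frac{\delta|\Omega_g|}{f}\text{ a.e.}\}$ and $\mathcal L^g_f=\{h\in L^2(\Omega_g):h\le1-\frac{\delta|\Omega_f|}{g}\text{ a.e.}\}$. A minimizer of (D) can be chosen in $\mathcal L^f_g\times\mathcal L^g_f$. The solution $\Phi$ of the Monge–Ampère equation is understood in the Brenier–McCann sense: $\Phi$ is convex on $\Omega_f$ and $\nabla\Phi$ pushes $k_x\mathcal L$ forward to $k_y\mathcal L$ (existence and uniqueness of $\nabla\Phi$ are known). The maps $\mathscr T_t$ are defined on $\Omega_f$, and $\Xi_t,\rho_t$ on $\mathscr T_t(\Omega_f)$. The continuity equation is understood in the distributional sense: $\frac{d}{dt}\int\varphi\,d\mu_t=\int\nabla\varphi\cdot\Xi_t\,d\mu_t+\int\varphi\rho_t\,d\mu_t$ for smooth test functions $\varphi$. *)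

(* Defs.v *)
From HB Require Import structures.
From mathcomp Require Import all_boot all_order all_algebra.
From mathcomp Require Import all_classical all_reals all_analysis.

Set Implicit Arguments.
Unset Strict Implicit.
Unset Printing Implicit Defensive.

Import Order.TTheory GRing.Theory Num.Theory.
Import numFieldNormedType.Exports.

Local Open Scope classical_set_scope.
Local Open Scope ring_scope.

(* The sigma-algebra on R^n generated by the coordinates, i.e. the Borel one. *)
Section measurable_rV.
Context {R : realType} (n : nat).

Let coord (i : 'I_n) (x : 'rV[R]_n) : R := x ord0 i.

Let rV_set0 : g_sigma_preimage coord set0.
Proof. exact: sigma_algebra0. Qed.

Let rV_setC A : g_sigma_preimage coord A -> g_sigma_preimage coord (~` A).
Proof. exact: sigma_algebraC. Qed.

Let rV_bigcup (F : (set 'rV[R]_n)^nat) :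
  (forall i, g_sigma_preimage coord (F i)) ->
  g_sigma_preimage coord (\bigcup_i F i).
Proof. exact: sigma_algebra_bigcup. Qed.

HB.instance Definition _ := @isMeasurable.Build default_measure_display
  'rV[R]_n (g_sigma_preimage coord) rV_set0 rV_setC rV_bigcup.

Lemma measurable_rV_coord (i : 'I_n) :
  measurable_fun [set: 'rV[R]_n] (fun x => x ord0 i).
Proof.
move=> _ Y mY; rewrite setTI; apply: sub_sigma_algebra => /=.
rewrite -bigcup_seq/=; exists i => /=; first by rewrite mem_index_enum.
by exists Y => //; rewrite setTI.
Qed.

Lemma measurable_fun_rVP d (T : measurableType d) (f : T -> 'rV[R]_n) :
  (forall i, measurable_fun [set: T] (fun t => f t ord0 i)) ->
  measurable_fun [set: T] f.
Proof.
move=> mf _ Y; rewrite setTI.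
suff : g_sigma_preimage coord `<=` [set B | measurable (f @^-1` B)] by apply.
apply: smallest_sub.
  split => /=.
  - by rewrite preimage_set0.
  - by move=> A mA; rewrite setTD preimage_setC; exact: measurableC.
  - by move=> F mF; rewrite preimage_bigcup; exact: bigcup_measurable.
rewrite -bigcup_seq; apply: bigcup_sub => i _ _ [B mB <-] /=.
rewrite setTI -[X in measurable X]setTI.
by rewrite -comp_preimage; exact: mf.
Qed.

End measurable_rV.

Section lebesgue_rV.
Context {R : realType}.
Local Open Scope ereal_scope.

Definition rcons_rV n (p : 'rV[R]_n * R) : 'rV[R]_n.+1 :=
  row_mx (p.2%:M : 'M[R]_1) p.1.

(* Iterated product of the one-dimensional Lebesgue measure; it is pinned down
   by its values on boxes, see lebesgue_rV_box. *)
Fixpoint lebesgue_rV n : set 'rV[R]_n -> \bar R :=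
  if n is n'.+1 then
    pushforward (lebesgue_rV (n:=n') \x (@lebesgue_measure R)) (@rcons_rV n')
  else \d_(0%R : 'rV[R]_0).

Lemma rcons_rV0 n (p : 'rV[R]_n * R) : rcons_rV p ord0 ord0 = p.2.
Proof.
rewrite /rcons_rV mxE; case: splitP => // j.
by rewrite ord1 !mxE mulr1n.
Qed.

Lemma rcons_rVS n (p : 'rV[R]_n * R) (i : 'I_n) :
  rcons_rV p ord0 (lift ord0 i) = p.1 ord0 i.
Proof.
rewrite /rcons_rV mxE; case: splitP => [j|j].
  by rewrite ord1.
by rewrite /= /bump /= => -[] /val_inj ->.
Qed.

Lemma measurable_rcons_rV n : measurable_fun setT (@rcons_rV n).
Proof.
apply: measurable_fun_rVP => i.
case: (unliftP ord0 i) => [j ->|->]; last first.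
  under eq_fun do rewrite rcons_rV0; exact: measurable_snd.
under eq_fun do rewrite rcons_rVS.
exact: (measurableT_comp (measurable_rV_coord j) measurable_fst).
Qed.

Let lebesgue_rV_measure n :
  exists m : {measure set 'rV[R]_n -> \bar R}, @lebesgue_rV n = m.
Proof.
elim: n => [|n [m mE]]; first by exists \d_(0%R : 'rV[R]_0).
exists (measure_function_pushforward__canonical__measure_function_Measure
  (m \x (@lebesgue_measure R)) (@measurable_rcons_rV n)).
by rewrite /= mE.
Qed.

Let lebesgue_rV0 n : @lebesgue_rV n set0 = 0.
Proof. by have [m ->] := lebesgue_rV_measure n; exact: measure0. Qed.

Let lebesgue_rV_ge0 n A : 0 <= @lebesgue_rV n A.
Proof. by have [m ->] := lebesgue_rV_measure n; exact: measure_ge0. Qed.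

Let lebesgue_rV_sigma_additive n : semi_sigma_additive (@lebesgue_rV n).
Proof.
have [m ->] := lebesgue_rV_measure n.
exact: measure_semi_sigma_additive.
Qed.

HB.instance Definition _ n := isMeasure.Build _ 'rV[R]_n R (@lebesgue_rV n)
  (lebesgue_rV0 n) (@lebesgue_rV_ge0 n) (@lebesgue_rV_sigma_additive n).

Lemma measurable_box n (A : 'I_n -> set R) : (forall i, measurable (A i)) ->
  measurable [set x : 'rV[R]_n | forall i, A i (x ord0 i)].
Proof.
move=> mA; rewrite [X in measurable X](_ : _ =
  \bigcap_(i in [set: 'I_n]) ((fun x : 'rV[R]_n => x ord0 i) @^-1` A i)); last first.
  by apply/seteqP; split=> x /= h i; [move=> _|]; exact: h.
apply: (@fin_bigcap_measurable _ _ 'I_n) => // i _; rewrite -[X in measurable X]setTI; exact: measurable_rV_coord.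
Qed.

Lemma lebesgue_rV_box n (A : 'I_n -> set R) : (forall i, measurable (A i)) ->
  lebesgue_rV [set x : 'rV[R]_n | forall i, A i (x ord0 i)] =
  \prod_(i < n) (@lebesgue_measure R) (A i).
Proof.
elim: n A => [|n IH] A mA.
  rewrite big_ord0 /= diracE mem_set//= => -[]//.
rewrite big_ord_recl -IH// /= /pushforward.
rewrite [X in (_ \x _) X](_ : _ =
  [set x : 'rV[R]_n | forall i, A (lift ord0 i) (x ord0 i)] `*` A ord0); last first.
  apply/seteqP; split=> -[x r] /=.
    move=> h; split=> [i|]; first by move: (h (lift ord0 i)); rewrite rcons_rVS.
    by move: (h ord0); rewrite rcons_rV0.
  move=> [h1 h2] i; case: (unliftP ord0 i) => [j ->|->].
    by rewrite rcons_rVS; exact: h1.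
  by rewrite rcons_rV0.
rewrite product_measure1E; [by rewrite muleC| |exact: mA].
exact: (measurable_box (A := fun i => A (lift ord0 i))).
Qed.

Let lebesgue_rV_sigma_finite n : sigma_finite [set: 'rV[R]_n] (@lebesgue_rV n).
Proof.
exists (fun k => [set x : 'rV[R]_n |
    forall i, (`[(- k%:R)%R, k%:R%R]%classic : set R) (x ord0 i)]).
  apply/seteqP; split=> // x _; near \oo => k; exists k => //= i.
  rewrite in_itv/= -ler_norml.
  have : (`|x| <= k%:R)%R by near: k; exact: nbhs_infty_ger.
  apply: le_trans; rewrite [leRHS]/Num.norm /= mx_normrE.
  by apply/bigmax_geP; right; exists (ord0, i).
move=> k; pose I (i : 'I_n) : set R := `[(- k%:R)%R, k%:R%R]%classic.
have mI i : measurable (I i) by exact: measurable_itv.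
split; first exact: (measurable_box mI).
rewrite (lebesgue_rV_box mI).
suff : \prod_(i < n) lebesgue_measure (I i) \is a fin_num by move/fin_numPlt => /andP[].
apply: (big_ind (fun x : \bar R => x \is a fin_num)) => // [x y|i _].
  exact: fin_numM.
by rewrite /I lebesgue_measure_itv/=; case: ifPn.
Unshelve. all: by end_near. Qed.

HB.instance Definition _ n := Measure_isSigmaFinite.Build _ _ _
  (@lebesgue_rV n) (lebesgue_rV_sigma_finite n).

End lebesgue_rV.

Section calculus.
Context {R : realType}.

Definition grad n (phi : 'rV[R]_n -> R) (x : 'rV[R]_n) : 'rV[R]_n :=
  \row_i 'D_(delta_mx ord0 i) phi x.

Definition dotrv n (u v : 'rV[R]_n) : R := \sum_i u ord0 i * v ord0 i.

Fixpoint class_C n (m : nat) (phi : 'rV[R]_n -> R) : Prop :=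
  if m is m'.+1 then
    (forall x, differentiable phi x) /\
    forall i, class_C m' (fun x => 'D_(delta_mx ord0 i) phi x)
  else continuous phi.

Definition test_function n (phi : 'rV[R]_n -> R) :=
  (forall m, class_C m phi) /\ compact (closure [set x | phi x != 0]).

Definition class_C11 n (phi : 'rV[R]_n -> R) :=
  (forall x, differentiable phi x) /\ lipschitz (@grad n phi).

(* Near each boundary point, in suitable orthonormal coordinates, A is the
   epigraph of a C^{1,1} function of the other n-1 coordinates. *)
Definition C11_boundary n (A : set 'rV[R]_n) :=
  forall p, (closure A `\` A°) p ->
    exists (Q : 'M[R]_n) (i : 'I_n) (gamma : 'rV[R]_n.-1 -> R),
      [/\ Q *m Q^T = 1%:M, class_C11 gamma &
          \forall x \near p,
            A x <-> gamma (col' i (x *m Q)) <= (x *m Q) ord0 i].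

(* The exponent and the constant may depend on the point. *)
Definition locally_holder (V : normedModType R) (F : V -> R) :=
  forall p : V, exists alpha L : R,
    0 < alpha <= 1 /\
    exists2 U, nbhs p U &
      forall z w, U z -> U w -> `|F z - F w| <= L * `|z - w| `^ alpha.

End calculus.

Section function_spaces.
Context {R : realType}.

Definition L2 d (X : measurableType d) (mu : {measure set X -> \bar R})
    (A : set X) : set (X -> R) :=
  [set u : X -> R | measurable_fun A u /\ (\int[mu]_(x in A) (u x ^+ 2)%:E < +oo)%E].

Definition L2ge d (X : measurableType d) (mu : {measure set X -> \bar R})
    (A : set X) (theta : R) : set (X -> R) :=
  [set u : X -> R | L2 mu A u /\ {ae mu, forall x, A x -> theta <= u x}].

Definition minimizer (X : Type) (D : set X) (J : X -> \bar R) (x : X) :=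
  D x /\ forall y, D y -> (J x <= J y)%E.

End function_spaces.

Section transport.
Context {R : realType} {d : nat}.
Local Notation E := 'rV[R]_d.
Local Notation leb := (@lebesgue_rV R d).
Local Notation leb2 := (leb \x leb)%E.
Implicit Types (f g u v h Phi : E -> R) (k C : E * E -> R) (theta delta : R).

(* The support of the measure with density f, which depends only on the a.e.
   class of f. *)
Definition esupp f : set E :=
  [set x | forall U, open_nbhs x U -> ~ {ae leb, forall y, U y -> f y = 0}].

Definition volume (A : set E) : R := fine (leb A).

Definition Minfty (c : R) f :=
  [/\ measurable_fun [set: E] f, finite_norm leb +oo%E f, compact (esupp f) &
      {ae leb, forall x, esupp f x -> c <= f x}].

(* The empty set, i.e. the zero measure, is excluded. *)
Definition convex_C11_domain (A : set E) :=
  [/\ A !=set0, convex_set A & C11_boundary A].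

Definition marginal_x g k (x : E) : R := \int[leb]_(y in esupp g) k (x, y).
Definition marginal_y f k (y : E) : R := \int[leb]_(x in esupp f) k (x, y).

Local Open Scope ereal_scope.

Definition pearson u v : \bar R :=
  \int[leb]_(x in esupp v) ((u x / v x - 1) ^+ 2 * v x)%:E.

Definition pearson_conj theta (ustar v : E -> R) : \bar R :=
  ereal_sup [set \int[leb]_(x in esupp v) (u x * ustar x)%:E - pearson u v |
             u in L2ge leb (esupp v) theta].

Definition sqL2norm (A : set (E * E)) k : \bar R :=
  \int[leb2]_(z in A) (k z ^+ 2)%:E.

Definition cost_conj delta C (A : set (E * E)) (wstar : E * E -> R) : \bar R :=
  ereal_sup [set \int[leb2]_(z in A) (k z * wstar z)%:E
                 - \int[leb2]_(z in A) (C z * k z)%:E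
                 - (2^-1)%:E * sqL2norm A k |
             k in L2ge leb2 A delta].

Definition primal C f g k : \bar R :=
  let Omega := esupp f `*` esupp g in
  \int[leb2]_(z in Omega) (C z * k z)%:E
  + (2^-1)%:E * sqL2norm Omega k
  + (2^-1)%:E * pearson (marginal_x g k) f
  + (2^-1)%:E * pearson (marginal_y f k) g.

Definition dual delta C f g (h : (E -> R) * (E -> R)) : \bar R :=
  cost_conj delta C (esupp f `*` esupp g) (fun z => h.1 z.1 + h.2 z.2)%R
  + (2^-1)%:E *
    pearson_conj (delta * volume (esupp g)) (fun x => - 2 * h.1 x)%R f
  + (2^-1)%:E *
    pearson_conj (delta * volume (esupp f)) (fun y => - 2 * h.2 y)%R g.

Local Close Scope ereal_scope.

(* dual_class delta f g and dual_class delta g f are the two classes in which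
   the dual minimizer is chosen. *)
Definition dual_class delta f g : set (E -> R) :=
  [set h | L2 leb (esupp f) h /\
     {ae leb, forall x, esupp f x -> h x <= 1 - delta * volume (esupp g) / f x}].

(* grad Phi makes sense only where Phi is differentiable. The interior is
   needed since the values of Phi off A are meaningless. *)
Definition grad_domain (A : set E) Phi : set E :=
  [set x | A° x /\ differentiable Phi x].

(* Weak solutions of ky (grad Phi) det (D^2 Phi) = kx: Phi is convex on A and
   grad Phi pushes the measure with density kx on A forward to the one with
   density ky on B. That grad Phi is defined a.e. and measurable, which holds
   for every convex Phi, is part of the meaning of the push-forward. *)
Definition brenier_mccann (A B : set E) (kx ky : E -> R) Phi :=
  let D := grad_domain A Phi in
  [/\ convex_function A Phi, leb.-negligible (A `\` D),
      measurable D, measurable_fun D (grad Phi) &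
      forall S, measurable S ->
        (\int[leb]_(x in D `&` grad Phi @^-1` S) (kx x)%:E =
         \int[leb]_(y in B `&` S) (ky y)%:E)%E].

Section flow.
Variables (T : R) (A : set E) (Phi k1 k2 : E -> R).

Definition interpolation (t : R) (x : E) : E :=
  ((T - t) / T) *: x + (t / T) *: grad Phi x.

Definition interpolation_image (t : R) : set E :=
  interpolation t @` grad_domain A Phi.

(* The inverse of interpolation t on its image, extended by 0. For t < T the
   interpolation is injective; otherwise a preimage is chosen. *)
Definition interpolation_inv (t : R) : E -> E :=
  'pinv_(fun=> 0) (grad_domain A Phi) (interpolation t).

Definition velocity (t : R) (x : E) : E :=
  let y := interpolation_inv t x in T^-1 *: (grad Phi y - y).

Definition growth (t : R) (x : E) : R :=
  let y := interpolation_inv t x in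
  T^-1 * (- (k1 y / (1 - t / T * k1 y))
          + k2 (grad Phi y) / (1 - t / T * k2 (grad Phi y))).

End flow.

(* Distributional solutions of d_t mu_t + div (Xi_t mu_t) = rho_t mu_t on
   [0, T]; Xi_t and rho_t are only defined on D t, which has to carry mu_t.
   Continuity up to t = 0 and t = T ties mu_0 and mu_T to the equation, which
   is only imposed in between. *)
Definition continuity_equation (T : R) (D : R -> set E) (Xi : R -> E -> E)
    (rho : R -> E -> R) (mu : R -> {finite_measure set E -> \bar R}) :=
  (forall t, 0 < t < T -> measurable (D t) /\ mu t (~` D t) = 0%E) /\
  forall phi, test_function phi ->
    {within `[0, T], continuous (fun t => \int[mu t]_x phi x)} /\
    forall t, 0 < t < T ->
      [/\ (mu t).-integrable (D t) (fun x => (dotrv (grad phi x) (Xi t x))%:E),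
          (mu t).-integrable (D t) (fun x => (phi x * rho t x)%:E) &
          is_derive t (1 : R) (fun t => \int[mu t]_x phi x)
            (\int[mu t]_(x in D t) dotrv (grad phi x) (Xi t x) +
             \int[mu t]_(x in D t) (phi x * rho t x))].

Definition has_density (mu : set E -> \bar R) f :=
  forall A, measurable A -> mu A = (\int[leb]_(x in A) (f x)%:E)%E.

End transport.

(* Main.v *)
Require Import Defs.
From HB Require Import structures.
From mathcomp Require Import all_boot all_order all_algebra.
From mathcomp Require Import all_classical all_reals all_analysis.
From mathcomp Require Import measurable_realfun lebesgue_integral_under ess_sup_inf.
From mathcomp Require Import ring lra.
Import Order.TTheory GRing.Theory Num.Theory.
Import numFieldNormedType.Exports.
Local Open Scope classical_set_scope.
Local Open Scope ring_scope.
Set Implicit Arguments.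
Unset Strict Implicit.
Unset Printing Implicit Defensive.

(** Why the theorem holds.

    Optimality.  Put w (x, y) = k1 x + k2 y and K = max (delta, w - C), and write
    k_x, k_y for the marginals of k.  The point is that
      k_x = f (1 - k1)  and  k_y = g (1 - k2)  almost everywhere.
    The conjugates in the dual problem are suprema of integrals of concave quadratics.
    The pointwise optimizer is K for the cost term and f (1 - k1), g (1 - k2) for the two
    divergence terms; the last two are admissible because k1 and k2 lie in the dual
    classes.  Completing squares bounds each conjugate at a perturbed argument by its
    value, a linear term and a quadratic one ([cost_conj_le], [pearson_conj_le]), so
    minimality of (k1, k2) becomes the Euler-Lagrange identity [dual_stationary]: the
    marginals of K are f (1 - k1) and g (1 - k2).  These are also the
    Karush-Kuhn-Tucker conditions of the primal problem at K: a square can be completed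
    again, and the primal value of k exceeds that of K by at least half the squared
    L2 distance, whence k = K ([primal_minimizerE]).

    Flow.  Write T_t for the interpolation between the identity and grad Phi, and let
    mu_t be the image under T_t of the measure with density
      m_t (x) = f x * (1 - t / T * k1 x) / (1 - t / T * k2 (grad Phi x)).
    At t = 0 this is f.  At t = T the density is k_x / (1 - k2 o grad Phi), and grad Phi
    pushes k_x forward to k_y = g (1 - k2), so that mu_T has density g ([flow_end]).  The
    logarithmic derivative of m_t in time is the growth rate and the time derivative of
    T_t the velocity, both read at T_t x, so the continuity equation is differentiation
    under the integral sign in the integral of phi (T_t x) m_t (x)
    ([is_derive_flow_integral], [flow_solves_continuity_equation]).

    Domination.  Membership in the dual classes gives 1 - k1 >= eta and 1 - k2 >= eta for
    some eta > 0, which bounds the denominators away from 0.  Everything is integrated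
    over a set of full measure in the support of f on which these bounds hold pointwise
    ([good_source], [good_source_full]).

    Measurability.  For t < T monotonicity of grad Phi makes the inverse of T_t Lipschitz
    on its image.  Extended to the whole space by an infimal convolution, it describes
    that image by measurable equations ([lipschitz_left_inverse], [measurable_image]).
    The function k2 is only measurable on the support of g, so k2 o grad Phi requires
    grad Phi to map every point of its domain into that support; this follows from the
    almost everywhere statement by the closed graph of the subdifferential
    ([gradient_closure], [gradient_in_target]). *)


(** * Borel sets of the space of row vectors *)

Section borel.
Context {R : realType} {d : nat}.
Local Notation E := 'rV[R]_d.
Local Notation leb := (@lebesgue_rV R d).

(** A countable base of the topology, indexed by [nat] through [pickle] so that unions over
    it are countable unions; numbers that encode nothing give the empty set. *)
Definition rat_ball (n : nat) : set E :=
  if unpickle n is Some (q, m) then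
    ball (map_mx (@ratr R) (q : 'rV[rat]_d)) m.+1%:R^-1
  else set0.

Lemma ball_rVE (x : E) (e : R) : 0 < e ->
  ball x e = [set y | forall i, ball (x ord0 i) e (y ord0 i)].
Proof.
move=> e0; apply/seteqP; split=> [y [_ xy] i|y xy]; first exact: xy.
by split=> // i j; rewrite ord1.
Qed.

Lemma rat_ball_measurable n : measurable (rat_ball n).
Proof.
rewrite /rat_ball; case: unpickle => [[q m]|]; last exact: measurable0.
rewrite ball_rVE ?invr_gt0//.
have := @measurable_box R d (fun i => ball (map_mx (@ratr R) q ord0 i : R) m.+1%:R^-1).
by apply=> i; exact: measurable_ball.
Qed.

(** Open sets are measurable, and null sets can be glued, because the topology has a
    countable base of boxes. *)
Lemma rat_ball_basis (U : set E) (x : E) : open U -> U x ->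
  exists n, rat_ball n x /\ rat_ball n `<=` U.
Proof.
move=> oU Ux.
have /nbhs_ballP[e /= e0 eU] := open_nbhs_nbhs (conj oU Ux).
have [m _ me] : exists2 m : nat, True & m.+1%:R^-1 < e / 2.
  have e2 : 0 < e / 2 by rewrite divr_gt0.
  have [m] : exists m : nat, m.+1%:R^-1 < e / 2.
    have [m _ /(_ m (leqnn m)) ?] := near_infty_natSinv_lt (PosNum e2).
    by exists m.
  by exists m.
have m0 : 0 < m.+1%:R^-1 :> R by rewrite invr_gt0.
have [q xq] : exists q : 'rV[rat]_d, forall i, ball (ratr (q ord0 i) : R) m.+1%:R^-1 (x ord0 i).
  have /choice[q qP] : forall i : 'I_d, exists r : rat, ball (ratr r : R) m.+1%:R^-1 (x ord0 i).
    move=> i.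
    have [||y [xy [r _ ry]]] := @dense_rat R (ball (x ord0 i) m.+1%:R^-1).
    - by exists (x ord0 i); exact: ballxx.
    - by rewrite ball_itv; exact: interval_open.
    by exists r; rewrite ry; exact: ball_sym.
  by exists (\row_i q i) => i; rewrite mxE.
have xq' : ball (map_mx (@ratr R) q) m.+1%:R^-1 x.
  by rewrite ball_rVE// => i; rewrite mxE.
exists (pickle (q, m)); rewrite /rat_ball pickleK; split=> // y qy.
apply: eU; apply: (@le_ball _ _ _ (m.+1%:R^-1 + m.+1%:R^-1)).
  by rewrite [leRHS]splitr lerD// ltW.
by apply: ball_triangle qy; exact: ball_sym.
Qed.

Lemma open_rV_measurable (U : set E) : open U -> measurable U.
Proof.
move=> oU; rewrite [X in measurable X](_ : U =
    \bigcup_(n in [set n | rat_ball n `<=` U]) rat_ball n); last first.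
  apply/seteqP; split=> [x Ux|x [n nU nx]]; last exact: nU.
  by have [n [nx nU]] := rat_ball_basis oU Ux; exists n.
by apply: bigcup_measurable => n _; exact: rat_ball_measurable.
Qed.

Lemma closed_rV_measurable (U : set E) : closed U -> measurable U.
Proof.
move=> cU; rewrite -[U]setCK; apply: measurableC; apply: open_rV_measurable.
exact: closed_openC.
Qed.

Lemma compact_rV_measurable (U : set E) : compact U -> measurable U.
Proof. 
by move=> cU; apply: closed_rV_measurable; apply: compact_closed => //; exact: norm_hausdorff. Qed.

Lemma continuous_rV_measurable (f : E -> R) :
  continuous f -> measurable_fun setT f.
Proof.
move=> cf; apply: (measurability _ (RGenOpens.measurableE R)).
move=> _ [_ [a [b ->] <-]].
rewrite setTI; apply: open_rV_measurable.
by move/continuousP : cf; apply; exact: interval_open.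
Qed.

Lemma coord_le_norm (x : E) i : `|x ord0 i| <= `|x|.
Proof.
rewrite [leRHS]/Num.norm /= mx_normrE.
by apply/bigmax_geP; right; exists (ord0, i).
Qed.

Lemma compact_rV_lty (A : set E) : compact A -> (leb A < +oo)%E.
Proof.
move=> cA; have [M [_ MA]] := compact_bounded cA.
have {}MA x : A x -> `|x| <= M + 1 by apply: MA; rewrite ltrDl.
pose I (i : 'I_d) : set R := `[(- (M + 1)), M + 1]%classic.
have mI i : measurable (I i) by exact: measurable_itv.
apply: (@le_lt_trans _ _ (leb [set x : E | forall i, I i (x ord0 i)])).
  apply: le_measure; rewrite ?inE; [exact: compact_rV_measurable|exact: measurable_box|].
  move=> x Ax i; rewrite /I/= in_itv/= -ler_norml.
  by rewrite (le_trans (coord_le_norm _ _))// MA.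
rewrite (lebesgue_rV_box mI).
suff : (\prod_(i < d) lebesgue_measure (I i))%E \is a fin_num by move/fin_numPlt => /andP[].
apply: (big_ind (fun x : \bar R => x \is a fin_num)) => // [x y|i _].
  exact: fin_numM.
by rewrite /I lebesgue_measure_itv/=; case: ifPn.
Qed.

End borel.

(** * Essential supports *)

Section support.
Context {R : realType} {d : nat}.
Local Notation E := 'rV[R]_d.
Local Notation leb := (@lebesgue_rV R d).
Implicit Types f : E -> R.

(** The complement of the support is a union of null open sets; by the countable base a
    countable subfamily already covers it. *)
Lemma ae_esuppC f : {ae leb, forall x, ~ esupp f x -> f x = 0}.
Proof.
pose null n := {ae leb, forall y, rat_ball n y -> f y = 0}.
pose F n := [set y : E | [/\ null n, rat_ball n y & f y <> 0]].
have : leb.-negligible (\bigcup_n F n).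
  apply: negligible_bigcup => n.
  have [nulln|nulln] := pselect (null n).
    by apply: negligibleS nulln => y [_ ny fy]/= fy0; exact/fy/fy0.
  by rewrite (_ : F n = set0); [exact: negligible_set0|apply/seteqP; split=> y []].
apply: negligibleS => x /=.
move=> /not_implyP[/existsNP[U /not_implyP[oUx /contrapT fU0]] fx0].
case: oUx => oU Ux.
have [n [nx nU]] := rat_ball_basis oU Ux.
by exists n => //; split=> //; apply: filterS fU0 => y fy /nU; exact: fy.
Qed.

(** If the support were null then f would vanish almost everywhere, on it as well as off it,
    and the support would be empty. *)
Lemma esupp_leb_gt0 f : esupp f !=set0 -> measurable (esupp f) ->
  (0 < leb (esupp f))%E.
Proof.
move=> [x fx] mf; rewrite lt0e measure_ge0 andbT; apply/eqP => f0.
have /(_ setT (conj openT I)) := fx; apply.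
have nf : leb.-negligible (esupp f) by apply/negligibleP.
have := negligibleU (ae_esuppC f) nf.
apply: negligibleS => y /= /not_implyP[_ fy0].
by have [fy|nfy] := pselect (esupp f y); [right|left=> fy; exact/fy0/fy].
Qed.

End support.


(** * Images of measures with a density *)

Section transported_measure.
Context dX dY (X : measurableType dX) (Y : measurableType dY) (R : realType).
Variables (mu : {measure set X -> \bar R}) (m : X -> R) (h : X -> Y).
Hypotheses (mm : measurable_fun setT m) (m_ge0 : forall x, 0 <= m x).
Hypothesis mh : measurable_fun setT h.

Local Open Scope ereal_scope.

Let mpre (A : set Y) : measurable A -> measurable (h @^-1` A).
Proof. by move=> mA; rewrite -[X in measurable X]setTI; exact: mh. Qed.

(** The map h is assumed measurable on the whole space; partially defined maps are extended
    arbitrarily where the density m vanishes. *)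
Lemma exists_transported_measure : \int[mu]_x (m x)%:E < +oo ->
  exists nu : {finite_measure set Y -> \bar R},
    forall A, measurable A -> nu A = \int[mu]_(x in h @^-1` A) (m x)%:E.
Proof.
move=> moo.
pose nu (A : set Y) := \int[mu]_(x in h @^-1` A) (m x)%:E.
have nu0 : nu set0 = 0 by rewrite /nu preimage_set0 integral_set0.
have nu_ge0 A : 0 <= nu A by apply: integral_ge0 => x _; rewrite lee_fin.
have nu_sa : semi_sigma_additive nu.
  move=> F mF tF mUF; rewrite /nu preimage_bigcup.
  rewrite ge0_integral_bigcup//=.
  - by apply: is_cvg_ereal_nneg_natsum => n _; exact: nu_ge0.
  - by move=> n; exact: mpre.
  - exact/measurable_EFinP/measurable_funTS.
  - by move=> x _; rewrite lee_fin.
  - apply/trivIsetP => /= i j _ _ ij; rewrite -preimage_setI.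
    by move/trivIsetP : tF => /(_ _ _ _ _ ij) ->//; rewrite preimage_set0.
have nu_fin : fin_num_fun nu.
  move=> A mA; rewrite ge0_fin_numE//; apply: le_lt_trans moo.
  apply: ge0_subset_integral => //; [exact: mpre|exact/measurable_EFinP|].
  by move=> x _; rewrite lee_fin.
pose M1 : {measure set Y -> \bar R} :=
  HB.pack nu (isMeasure.Build _ Y R nu nu0 nu_ge0 nu_sa).
pose M2 : {finite_measure set Y -> \bar R} :=
  HB.pack nu M1 (Measure_isFinite.Build _ Y R M1 nu_fin).
by exists M2.
Qed.

Import HBNNSimple.

(** The characterisation of nu is a hypothesis rather than the definition of nu, so that one
    measure can be described as the image of two different densities; comparing both
    formulas is how the change of variables for the gradient is obtained. *)
Lemma ge0_integral_transported (nu : {measure set Y -> \bar R}) (phi : Y -> \bar R) :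
  (forall A, measurable A -> nu A = \int[mu]_(x in h @^-1` A) (m x)%:E) ->
  measurable_fun setT phi -> (forall y, 0 <= phi y) ->
  \int[nu]_y phi y = \int[mu]_x (phi (h x) * (m x)%:E).
Proof.
move=> nuE mphi phi_ge0; pose s := nnsfun_approx measurableT mphi.
have sP y : EFin \o s ^~ y @ \oo --> phi y.
  by apply: cvg_nnsfun_approx => // *; exact: phi_ge0.
transitivity (limn (fun n => \int[nu]_y (s n y)%:E)).
  rewrite -monotone_convergence//.
  - by apply: eq_integral => y _; apply/esym/cvg_lim => //; exact: sP.
  - by move=> n; exact/measurable_EFinP/measurable_funP.
  - by move=> n y _; rewrite lee_fin.
  - by move=> y _ a b ab; rewrite lee_fin; exact/lefP/nd_nnsfun_approx.
transitivity (limn (fun n => \int[mu]_x ((s n (h x))%:E * (m x)%:E))); last first.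
  rewrite -monotone_convergence//.
  - apply: eq_integral => x _; apply/cvg_lim => //.
    by apply: cvgeZr => //; exact: sP.
  - move=> n; apply: emeasurable_funM; last exact/measurable_EFinP.
    by apply/measurable_EFinP/measurableT_comp => //; exact/measurable_funP.
  - by move=> n x _; rewrite mule_ge0// lee_fin.
  - move=> x _ a b ab; rewrite lee_wpmul2r ?lee_fin//.
    exact/lefP/nd_nnsfun_approx.
congr (limn _); apply/funext => n.
(* Both sides are limits along simple functions, for which the identity is the
   characterisation of nu. *)
rewrite integralT_nnsfun sintegralE.
transitivity (\int[mu]_x (\sum_(r \in range (s n))
    (r%:E * (\1_(h @^-1` (s n @^-1` [set r])) x * m x)%:E))); last first.
  apply: eq_integral => x _; rewrite [in RHS]fimfunE -fsumEFin//.
  rewrite ge0_mule_fsuml; last by move=> r; exact: nnfun_muleindic_ge0.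
  by apply: eq_fsbigr => r _; rewrite EFinM muleA -!EFinM.
have mpres r : measurable (h @^-1` (s n @^-1` [set r])) by exact/mpre.
rewrite ge0_integral_fsum//; last 2 first.
- move=> r; apply: emeasurable_funM => //; apply/measurable_EFinP.
  by apply: measurable_funM => //.
- move=> r x _; have [r0|r0] := leP 0%R r.
    by rewrite mule_ge0// ?lee_fin ?mulr_ge0.
  by rewrite preimage_nnfun0// preimage_set0 indicE in_set0 mul0r mule0.
apply: eq_fsbigr => r; rewrite inE/= => -[y _ <-].
rewrite ge0_integralZl//; last 3 first.
- by apply/measurable_EFinP/measurable_funM.
- by move=> x _; rewrite lee_fin mulr_ge0.
- by rewrite lee_fin.
congr (_ * _); rewrite nuE// integral_mkcond; apply: eq_integral => x _.
by rewrite patchE indicE; case: ifP; rewrite ?mul1r ?mul0r.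
Qed.

Lemma integrable_transported (nu : {measure set Y -> \bar R}) (D : set Y)
    (phi : Y -> R) :
  (forall A, measurable A -> nu A = \int[mu]_(x in h @^-1` A) (m x)%:E) ->
  measurable D -> measurable_fun D phi ->
  mu.-integrable (h @^-1` D) (fun x => (phi (h x) * m x)%:E) ->
  nu.-integrable D (EFin \o phi).
Proof.
move=> nuE mD mphi /integrableP[_ ioo]; apply/integrableP; split.
  exact/measurable_EFinP.
have mpD : measurable_fun setT (fun y => (`|(phi \_ D) y|)%:E).
  apply/measurable_EFinP/measurableT_comp => //.
  by apply/(measurable_restrictT _ mD).
rewrite (_ : \int[nu]_(x in D) _ = \int[nu]_y (`|(phi \_ D) y|)%:E).
  rewrite (ge0_integral_transported nuE)//.
  apply: le_lt_trans ioo; rewrite le_eqVlt; apply/orP; left; apply/eqP.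
  rewrite [RHS]integral_mkcond; apply: eq_integral => x _.
  rewrite !patchE (_ : (x \in h @^-1` D) = (h x \in D))//.
  case: ifPn => _; first by rewrite -EFinM/= normrM (ger0_norm (m_ge0 _)).
  by rewrite normr0 mul0e.
rewrite integral_mkcond; apply: eq_integral => y _.
by rewrite !patchE; case: ifPn => //=; rewrite normr0.
Qed.

Lemma Rintegral_transported (nu : {measure set Y -> \bar R}) (D : set Y)
    (phi : Y -> R) :
  (forall A, measurable A -> nu A = \int[mu]_(x in h @^-1` A) (m x)%:E) ->
  measurable D -> measurable_fun D phi ->
  (\int[nu]_(y in D) phi y = \int[mu]_(x in h @^-1` D) (phi (h x) * m x))%R.
Proof.
move=> nuE mD mphi; rewrite /Rintegral; congr fine.
pose psi := phi \_ D.
have mpsi : measurable_fun setT psi by exact/(measurable_restrictT _ mD).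
rewrite [LHS](_ : _ = \int[nu]_y (psi y)%:E); last first.
  rewrite integral_mkcond; apply: eq_integral => y _.
  by rewrite /psi !patchE; case: ifPn.
rewrite [RHS](_ : _ = \int[mu]_x (psi (h x) * m x)%:E); last first.
  rewrite [LHS]integral_mkcond; apply: eq_integral => x _.
  rewrite /psi !patchE (_ : (x \in h @^-1` D) = (h x \in D))//.
  by case: ifPn => // _; rewrite mul0r.
rewrite integralE [RHS]integralE; congr (_ - _).
  rewrite (ge0_integral_transported nuE)//; last first.
    by apply: measurable_funepos; exact/measurable_EFinP.
  apply: eq_integral => x _; rewrite !funeposE/= -!EFin_max -EFinM; congr EFin.
  by rewrite maxr_pMl// mul0r.
rewrite (ge0_integral_transported nuE)//; last first.
  by apply: measurable_funeneg; exact/measurable_EFinP.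
apply: eq_integral => x _; rewrite !funenegE/= -!EFin_max -EFinM; congr EFin.
by rewrite maxr_pMl// mul0r mulNr.
Qed.

End transported_measure.


(** * Almost everywhere comparison of integrals *)

Lemma measurable_invr (R : realType) : measurable_fun setT (@GRing.inv R).
Proof.
rewrite -(setvU [set 0 : R]); apply/measurable_funU => //.
  exact: measurableC.
split; last exact: measurable_fun_set1.
apply: open_continuous_measurable_fun.
  by apply: closed_openC; exact: closed_eq.
by move=> x; rewrite inE/= => /eqP x0; exact: inv_continuous.
Qed.

Section integration_toolkit.
Context dX (X : measurableType dX) (R : realType).
Variables (mu : {measure set X -> \bar R}) (A : set X).
Hypothesis mA : measurable A.
Implicit Types u v w : X -> R.
Local Notation integ u := (mu.-integrable A (fun x => (u x)%:E)).

Lemma integrable_measurable u : integ u -> measurable_fun A u.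
Proof. by move=> iu; apply/measurable_EFinP; exact: measurable_int iu. Qed.

Lemma integrable_addr u v : integ u -> integ v -> integ (fun x => u x + v x).
Proof.
by move=> iu iv; have := integrableD mA iu iv; apply: eq_integrable.
Qed.

Lemma integrable_scaler a u : integ u -> integ (fun x => a * u x).
Proof. by move=> iu; have := integrableZl mA a iu; apply: eq_integrable. Qed.

Lemma integrable_subr u v : integ u -> integ v -> integ (fun x => u x - v x).
Proof. by move=> iu iv; have := integrableB mA iu iv; apply: eq_integrable. Qed.

Lemma integralrE u : integ u ->
  (\int[mu]_(x in A) (u x)%:E = (\int[mu]_(x in A) u x)%:E)%E.
Proof. by move=> iu; rewrite /Rintegral fineK//; exact: integrable_fin_num. Qed.

(** Only the minorant is assumed integrable; the majorant may have an infinite integral.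
    This yields lower bounds for a divergence which is not known to be finite. *)
Lemma ae_le_integral_lower u (psi : X -> \bar R) :
  integ u -> measurable_fun A psi ->
  {ae mu, forall x, A x -> ((u x)%:E <= psi x)%E} ->
  (\int[mu]_(x in A) (u x)%:E <= \int[mu]_(x in A) psi x)%E.
Proof.
move=> iu mpsi le_u; have mu' := measurable_int _ iu.
rewrite integralE [leRHS]integralE; apply: leeB.
  apply: ae_ge0_le_integral => //; [exact: measurable_funepos..|].
  apply: filterS le_u => x ux Ax; rewrite !funeposE.
  by rewrite ge_max !le_max ux//= lexx !orbT.
apply: ae_ge0_le_integral => //; [exact: measurable_funeneg..|].
apply: filterS le_u => x ux Ax; rewrite !funenegE.
by rewrite ge_max !le_max leeN2 ux//= lexx !orbT.
Qed.

Lemma ae_le_integrable u v : measurable_fun A u -> integ v ->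
  {ae mu, forall x, A x -> `|u x| <= v x} -> integ u.
Proof.
move=> mu_ iv uv; apply/integrableP; split; first exact/measurable_EFinP.
have /integrableP[_] := iv; apply: le_lt_trans.
apply: ae_ge0_le_integral => //.
- by apply: measurableT_comp => //; exact/measurable_EFinP.
- by apply: measurableT_comp => //; exact: measurable_int iv.
by apply: filterS uv => x uv /uv {}uv; rewrite lee_fin (le_trans uv)// ler_norm.
Qed.

Lemma ae_le_Rintegral u v : integ u -> integ v ->
  {ae mu, forall x, A x -> u x <= v x} ->
  \int[mu]_(x in A) u x <= \int[mu]_(x in A) v x.
Proof.
move=> iu iv uv; rewrite -lee_fin -!integralrE//.
by apply: ae_le_integral_lower => //; exact: measurable_int iv.
Qed.

Lemma ae_eq_Rintegral u v : integ u -> integ v ->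
  {ae mu, forall x, A x -> u x = v x} ->
  \int[mu]_(x in A) u x = \int[mu]_(x in A) v x.
Proof.
move=> iu iv uv; apply/eqP; rewrite eq_le; apply/andP; split;
  by apply: ae_le_Rintegral => //; apply: filterS uv => x /[apply] ->.
Qed.

Lemma Rintegral_sqr_eq0 u : integ (fun x => u x ^+ 2) ->
  \int[mu]_(x in A) (u x ^+ 2) <= 0 -> measurable_fun A u ->
  {ae mu, forall x, A x -> u x = 0}.
Proof.
move=> iu2 u2 mu_.
have : (\int[mu]_(x in A) `|(u x ^+ 2)%:E| = 0)%E.
  apply/eqP; rewrite eq_le integral_ge0// andbT.
  under eq_integral do rewrite gee0_abs ?lee_fin ?sqr_ge0//.
  by rewrite integralrE// lee_fin.
move/(ae_eq_integral_abs mu mA (measurable_int _ iu2)).1.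
by apply: filterS => x /= u0 Ax; have [/eqP] := u0 Ax; rewrite sqrf_eq0 => /eqP.
Qed.

(** * Square integrable functions *)

Lemma L2P u : L2 mu A u <-> measurable_fun A u /\ integ (fun x => u x ^+ 2).
Proof.
split=> [[mu_ u2]|[mu_ /integrableP[_ u2]]]; split => //.
  apply/integrableP; split; first exact/measurable_EFinP/measurable_funX.
  by under eq_integral do rewrite gee0_abs ?lee_fin ?sqr_ge0//.
apply: le_lt_trans u2; apply: ge0_le_integral => //.
- by move=> x _; rewrite lee_fin sqr_ge0.
- exact/measurable_EFinP/measurable_funX.
- by apply: measurableT_comp => //; exact/measurable_EFinP/measurable_funX.
- by move=> x _; rewrite gee0_abs// lee_fin sqr_ge0.
Qed.

Lemma L2_ae_le u v : measurable_fun A u -> L2 mu A v ->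
  {ae mu, forall x, A x -> `|u x| <= `|v x|} -> L2 mu A u.
Proof.
move=> mu_ /L2P[_ iv] uv; apply/L2P; split=> //.
apply: ae_le_integrable iv _ => //; first exact: measurable_funX.
apply: filterS uv => x uv /uv {}uv.
by rewrite normrX -(real_normK (num_real (v x))) lerXn2r// nnegrE.
Qed.

(** 2 |u v| <= u^2 + v^2. *)
Lemma L2M u v : L2 mu A u -> L2 mu A v -> integ (fun x => u x * v x).
Proof.
move=> /L2P[mu_ iu] /L2P[mv iv].
apply: (@ae_le_integrable _ (fun x => u x ^+ 2 + v x ^+ 2)) => //.
- exact: measurable_funM.
- exact: integrable_addr.
- apply: aeW => x _; rewrite normrM -(real_normK (num_real (u x))) -(real_normK (num_real (v x))).
  have := sqr_ge0 (`|u x| - `|v x|); have := sqr_ge0 (`|u x| + `|v x|).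
  rewrite sqrrB sqrrD; move: (`|u x|) (`|v x|) => a b; lra.
Qed.

Lemma L2D u v : L2 mu A u -> L2 mu A v -> L2 mu A (fun x => u x + v x).
Proof.
move=> hu hv; have /L2P[mu_ iu] := hu; have /L2P[mv iv] := hv.
apply/L2P; split; first exact: measurable_funD.
have := integrable_addr (integrable_addr iu iv) (integrable_scaler 2 (L2M hu hv)).
by apply: eq_integrable => // x _ /=; congr EFin; ring.
Qed.

Lemma L2_lin a u b v : L2 mu A u -> L2 mu A v ->
  L2 mu A (fun x => a * u x + b * v x).
Proof.
have L2Z c w : L2 mu A w -> L2 mu A (fun x => c * w x).
  move=> /L2P[mw iw]; apply/L2P; split; first exact: measurable_funM.
  have := integrable_scaler (c ^+ 2) iw.
  by apply: eq_integrable => // x _ /=; congr EFin; rewrite exprMn.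
by move=> hu hv; apply: L2D; exact: L2Z.
Qed.

Lemma L2Z c u : L2 mu A u -> L2 mu A (fun x => c * u x).
Proof.
move=> hu; have := L2_lin c 0 hu hu; congr (L2 _ _).
by apply/funext => x; rewrite mul0r addr0.
Qed.

Lemma L2B u v : L2 mu A u -> L2 mu A v -> L2 mu A (fun x => u x - v x).
Proof.
move=> hu hv; have := L2_lin 1 (-1) hu hv; congr (L2 _ _).
by apply/funext => x; rewrite mul1r mulN1r.
Qed.

Lemma L2_bddM u v M : measurable_fun A v -> {ae mu, forall x, A x -> `|v x| <= M} ->
  L2 mu A u -> L2 mu A (fun x => v x * u x).
Proof.
move=> mv vM hu; have /L2P[mu_ iu] := hu.
apply: L2_ae_le (L2Z M hu) _; first exact: measurable_funM.
apply: filterS vM => x vM /vM {}vM; rewrite !normrM ler_wpM2r//.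
by rewrite (le_trans vM)// ler_norm.
Qed.

Hypothesis Aoo : (mu A < +oo)%E.

Lemma L2_cst c : L2 mu A (cst c).
Proof.
apply/L2P; split; first exact: measurable_cst.
apply/integrableP; split; first exact/measurable_EFinP/measurable_funX/measurable_cst.
rewrite (_ : (\int[mu]_(x in A) _ = `|c ^+ 2|%:E * mu A)%E); last first.
  by rewrite -integral_cst.
by rewrite lte_mul_pinfty ?lee_fin.
Qed.

Lemma L2_bounded u M : measurable_fun A u ->
  {ae mu, forall x, A x -> `|u x| <= M} -> L2 mu A u.
Proof.
move=> mu_ uM; apply: L2_ae_le (L2_cst M) _ => //.
by apply: filterS uM => x uM /uM {}uM; rewrite (le_trans uM)// ler_norm.
Qed.

Lemma L2_integrable u : L2 mu A u -> integ u.
Proof.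
move=> hu; have := L2M hu (L2_cst 1).
by apply: eq_integrable => // x _; rewrite mulr1.
Qed.

Lemma L2_maxr c u : L2 mu A u -> L2 mu A (fun x => Num.max c (u x)).
Proof.
move=> hu; have /L2P[mu_ _] := hu.
have nu : L2 mu A (fun x => `|u x|).
  by apply: L2_ae_le hu _; [exact: measurableT_comp|apply: aeW => x _; rewrite normr_id].
apply: L2_ae_le (L2D (L2_cst `|c|) nu) _; first exact: measurable_maxr.
apply: aeW => x _; rewrite [leRHS]ger0_norm ?addr_ge0//=.
by rewrite maxEle; case: ifPn => _; rewrite ?lerDl ?lerDr.
Qed.

End integration_toolkit.


(** * Marginals and products *)

Section marginals.
Context dX dY (X : measurableType dX) (Y : measurableType dY) (R : realType).
Variables (m1 : {sigma_finite_measure set X -> \bar R}).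
Variables (m2 : {sigma_finite_measure set Y -> \bar R}).
Variables (A : set X) (B : set Y).
Hypotheses (mA : measurable A) (mB : measurable B).
Local Notation m12 := (m1 \x m2)%E.
Implicit Types k : X * Y -> R.

Let mAB : measurable (A `*` B). Proof. exact: measurableX. Qed.

Let patchAB k (x : X) : A x -> (fun y => ((k \_ (A `*` B)) (x, y))%:E) =
  (fun y => (k (x, y))%:E) \_ B.
Proof.
move=> Ax; apply/funext => y; rewrite !patchE.
rewrite (_ : ((x, y) \in A `*` B) = (y \in B)); first by case: ifP.
by apply/idP/idP; rewrite !inE => // -[].
Qed.

Let integrable_patch k : m12.-integrable (A `*` B) (EFin \o k) ->
  m12.-integrable setT (EFin \o (k \_ (A `*` B))).
Proof.
move=> /(integrable_mkcond _ mAB); apply: eq_integrable => // z _.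
by rewrite /= !patchE; case: ifP.
Qed.

Lemma measurable_marginal1 k : m12.-integrable (A `*` B) (EFin \o k) ->
  measurable_fun A (fun x => \int[m2]_(y in B) k (x, y)).
Proof.
move=> /integrable_patch/measurable_fubini_F mF.
apply: (eq_measurable_fun (fun x => fine (fubini_F m2 (EFin \o (k \_ (A `*` B))) x))).
  move=> x /[!inE] Ax; rewrite /fubini_F/= patchAB// -integral_mkcond.
  by [].
by apply: measurable_funTS; exact: measurableT_comp.
Qed.

(** Fubini on a rectangle, with a weight on the first factor. The marginal is finite only
    almost everywhere, which is why the weight is not simply taken out of the inner
    integral. *)
Lemma marginal1P k (psi : X -> R) : measurable_fun A psi ->
  m12.-integrable (A `*` B) (EFin \o k) ->
  m12.-integrable (A `*` B) (fun z => (k z * psi z.1)%:E) ->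
  m1.-integrable A (fun x => ((\int[m2]_(y in B) k (x, y)) * psi x)%:E) /\
  \int[m12]_(z in A `*` B) (k z * psi z.1) =
  \int[m1]_(x in A) ((\int[m2]_(y in B) k (x, y)) * psi x).
Proof.
move=> mpsi ik ikpsi; pose phi := (fun z => k z * psi z.1) \_ (A `*` B).
have iphi : m12.-integrable setT (EFin \o phi) by exact: integrable_patch.
pose F := fubini_F m2 (EFin \o phi).
have mF : measurable_fun setT F by exact: measurable_fubini_F iphi.
have mmarg : measurable_fun A
    (fun x => ((\int[m2]_(y in B) k (x, y)) * psi x)%:E).
  by apply/measurable_EFinP/measurable_funM => //; exact: measurable_marginal1.
(* The real-valued marginal agrees with the inner extended real integral where the
   section of k is integrable. *)
have FE : {ae m1, forall x, A x ->
    ((\int[m2]_(y in B) k (x, y)) * psi x)%:E = F x}.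
  have := ae_integrable1 (integrable_patch ik); apply: filterS => x /= ikx Ax.
  rewrite /F /fubini_F/= /phi patchAB// -integral_mkcond/=.
  have {}ikx : m2.-integrable B (fun y => (k (x, y))%:E).
    by apply/(integrable_mkcond _ mB); rewrite -patchAB.
  rewrite integralrE ?RintegralZr//.
  by have := integrableZr mB (psi x) ikx; apply: eq_integrable.
have F0 x : ~ A x -> F x = 0%E.
  move=> nAx; rewrite /F /fubini_F; apply: integral0_eq => y _ /=.
  by rewrite /phi patchE memNset// => -[].
have FA : F \_ A = F.
  apply/funext => x; rewrite patchE; case: ifPn => //; rewrite notin_setE.
  by move/F0.
have iF : m1.-integrable A F.
  by apply: integrableS (integrable_fubini_F iphi) => //.
have imarg : m1.-integrable A
    (fun x => ((\int[m2]_(y in B) k (x, y)) * psi x)%:E).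
  apply/integrableP; split=> //; have /integrableP[_] := iF.
  rewrite (@ae_eq_integral _ _ _ m1 A
    (abse \o (fun x => ((\int[m2]_(y in B) k (x, y)) * psi x)%:E))) //.
  - by apply: measurableT_comp => //; exact: measurable_funTS.
  - exact: measurableT_comp.
  - by apply: filterS FE => x FE Ax; rewrite /= -FE.
split=> //; apply: EFin_inj; rewrite -!integralrE//.
rewrite (ae_eq_integral F)//; last exact: measurable_funTS.
rewrite [RHS]integral_mkcond FA integral12_prod_meas1//.
by rewrite integral_mkcond; apply: eq_integral => z _; rewrite /phi/= !patchE; case: ifP.
Qed.

Lemma measurable_fun_fst (h : X -> R) :
  measurable_fun A h -> measurable_fun (A `*` B) (h \o fst).
Proof.
move=> mh; apply: (@measurable_comp _ _ _ _ _ _ A) => //.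
  by move=> _ [z [Az _] <-].
by apply: measurable_funTS; exact: measurable_fst.
Qed.

Lemma L2_fst (h : X -> R) : (m2 B < +oo)%E -> L2 m1 A h ->
  L2 m12 (A `*` B) (h \o fst).
Proof.
move=> Boo /(L2P _ mA)[mh ih]; apply/(L2P _ mAB); split; first exact: measurable_fun_fst.
pose phi := (fun z => h z.1 ^+ 2) \_ (A `*` B) : X * Y -> R.
have mphi : measurable_fun setT phi.
  apply/(measurable_restrictT _ mAB)/measurable_funX; exact: measurable_fun_fst.
suff : m12.-integrable setT (EFin \o phi).
  move=> iphi; apply/(integrable_mkcond _ mAB); apply: eq_integrable iphi => // z _.
  by rewrite /phi/= !patchE; case: ifP.
apply/integrable12ltyP; first by exact/measurable_EFinP.
apply: (@le_lt_trans _ _ (\int[m1]_x ((m2 B) * (((fun x => (h x ^+ 2)%:E) \_ A) x))))%E.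
  apply: ge0_le_integral => //.
  - by move=> x _; exact: integral_ge0.
  - apply: (@measurable_fun_fubini_tonelli_F _ _ _ _ _ m2 (fun z => `|(phi z)%:E|)%E) => //.
    by apply: measurableT_comp => //; exact/measurable_EFinP.
  - apply: emeasurable_funM => //; apply/(measurable_restrictT _ mA).
    exact/measurable_EFinP/measurable_funX.
  - move=> x _; have [Ax|nAx] := pselect (A x).
      rewrite patchE mem_set//.
      rewrite (_ : (fun y => _) = (fun y => `|(h x ^+ 2)%:E|)%E \_ B); last first.
        apply/funext => y; rewrite /phi/= !patchE.
        rewrite (_ : ((x, y) \in A `*` B) = (y \in B)); first by case: ifP => //=; rewrite normr0.
        by apply/idP/idP; rewrite !inE => // -[].
      rewrite -integral_mkcond (_ : (\int[m2]_(y in B) _ = `|(h x ^+ 2)%:E| * m2 B)%E); last first.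
        by rewrite -integral_cst.
      by rewrite gee0_abs ?lee_fin ?sqr_ge0// muleC.
    rewrite integral0_eq; last first.
      by move=> y _; rewrite /phi/= patchE memNset ?normr0// => -[].
    by rewrite patchE memNset// mule0.
rewrite ge0_integralZl//; last 2 first.
- by apply/(measurable_restrictT _ mA); exact/measurable_EFinP/measurable_funX.
- by move=> x _; rewrite patchE; case: ifP => // _; rewrite lee_fin sqr_ge0.
rewrite -integral_mkcond lte_mul_pinfty ?ge0_fin_numE//.
have /integrableP[_] := ih.
by under eq_integral do rewrite gee0_abs ?lee_fin ?sqr_ge0//.
Qed.

End marginals.

Section swapped_product.
Context dX dY (X : measurableType dX) (Y : measurableType dY) (R : realType).
Variables (m1 : {sigma_finite_measure set X -> \bar R}).
Variables (m2 : {sigma_finite_measure set Y -> \bar R}).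
Variables (A : set X) (B : set Y).
Hypotheses (mA : measurable A) (mB : measurable B).

Let swap_preimage (S : set X) (T : set Y) : swap_pair @^-1` (S `*` T) = T `*` S.
Proof. by apply/seteqP; split=> -[y x] [/= ? ?]; split. Qed.

Let M : {measure set (X * Y) -> \bar R} :=
  measure_function_pushforward__canonical__measure_function_Measure
    (m2 \x m1)%E (@measurable_swap _ _ Y X).

Let swapE (S : set (X * Y)) : measurable S -> (m1 \x m2)%E S = M S.
Proof.
move=> mS; have := @product_measure_unique _ _ _ _ _ m1 m2 M _ _ mS; apply.
move=> S' T mS' mT; rewrite /M/= /pushforward swap_preimage.
by rewrite product_measure1E// muleC.
Qed.

(** Exchanging the factors reduces the statements about the second marginal to those about
    the first one. *)
Lemma integral_swap (phi : X * Y -> \bar R) : measurable_fun (A `*` B) phi ->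
  (forall z, (A `*` B) z -> (0 <= phi z)%E) ->
  (\int[(m1 \x m2)%E]_(z in A `*` B) phi z =
   \int[(m2 \x m1)%E]_(z in B `*` A) phi (swap_pair z))%E.
Proof.
move=> mphi phi0.
rewrite (@eq_measure_integral _ _ _ _ M); last by move=> S mS _; exact: swapE.
rewrite [LHS](ge0_integral_pushforward (@measurable_swap _ _ Y X))//; last 2 first.
- exact: measurableX.
- by move=> z /[!inE]; exact: phi0.
by rewrite swap_preimage.
Qed.

Lemma integrable_swap (k : X * Y -> R) :
  (m1 \x m2)%E.-integrable (A `*` B) (EFin \o k) ->
  (m2 \x m1)%E.-integrable (B `*` A) (EFin \o k \o swap_pair).
Proof.
move=> /integrableP[mk koo]; apply/integrableP; split.
  apply: (@measurable_comp _ _ _ _ _ _ (A `*` B)) => //.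
  - exact: measurableX.
  - by move=> _ [z [Bz Az] <-].
  - by apply: measurable_funTS; exact: measurable_swap.
by move: koo; rewrite integral_swap//; exact: measurableT_comp.
Qed.

Lemma Rintegral_swap (k : X * Y -> R) : measurable_fun (A `*` B) k ->
  \int[(m1 \x m2)%E]_(z in A `*` B) k z =
  \int[(m2 \x m1)%E]_(z in B `*` A) k (swap_pair z).
Proof.
move=> mk; rewrite /Rintegral; congr fine.
have mk' : measurable_fun (A `*` B) (EFin \o k) by exact/measurable_EFinP.
rewrite integralE [RHS]integralE; congr (_ - _)%E.
  rewrite [LHS](@integral_swap (EFin \o k)^\+%E (measurable_funepos mk'))//.
  by apply: eq_integral => z _; rewrite !funeposE.
rewrite [LHS](@integral_swap (EFin \o k)^\-%E (measurable_funeneg mk'))//.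
by apply: eq_integral => z _; rewrite !funenegE.
Qed.

End swapped_product.


Section second_marginal.
Context dX dY (X : measurableType dX) (Y : measurableType dY) (R : realType).
Variables (m1 : {sigma_finite_measure set X -> \bar R}).
Variables (m2 : {sigma_finite_measure set Y -> \bar R}).
Variables (A : set X) (B : set Y).
Hypotheses (mA : measurable A) (mB : measurable B).
Local Notation m12 := (m1 \x m2)%E.

Lemma measurable_marginal2 (k : X * Y -> R) :
  m12.-integrable (A `*` B) (EFin \o k) ->
  measurable_fun B (fun y => \int[m1]_(x in A) k (x, y)).
Proof. by move=> /(integrable_swap mA mB)/(measurable_marginal1 mB mA). Qed.

Lemma marginal2P (k : X * Y -> R) (psi : Y -> R) : measurable_fun B psi ->
  m12.-integrable (A `*` B) (EFin \o k) ->
  m12.-integrable (A `*` B) (fun z => (k z * psi z.2)%:E) ->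
  m2.-integrable B (fun y => ((\int[m1]_(x in A) k (x, y)) * psi y)%:E) /\
  \int[m12]_(z in A `*` B) (k z * psi z.2) =
  \int[m2]_(y in B) ((\int[m1]_(x in A) k (x, y)) * psi y).
Proof.
move=> mpsi ik ikpsi; have mAB := measurableX mA mB.
rewrite (Rintegral_swap _ _ mA mB); last exact: integrable_measurable ikpsi.
exact: (marginal1P mB mA mpsi (integrable_swap mA mB ik)
  (integrable_swap mA mB ikpsi)).
Qed.

Lemma L2_snd (h : Y -> R) : (m1 A < +oo)%E -> L2 m2 B h ->
  L2 m12 (A `*` B) (h \o snd).
Proof.
move=> Aoo h2; have /(L2P _ (measurableX mB mA))[_ ih] := L2_fst mB mA Aoo h2.
apply/(L2P _ (measurableX mA mB)); split.
  apply: (@measurable_comp _ _ _ _ _ _ B) => //.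
  - by move=> _ [z [_ Bz] <-].
  - by have /(L2P _ mB)[] := h2.
  - by apply: measurable_funTS; exact: measurable_snd.
exact: (integrable_swap mB mA ih).
Qed.

End second_marginal.


(** * The two conjugate functionals *)

Section cost_conjugate.
Context {R : realType} {d : nat}.
Local Notation E := 'rV[R]_d.
Local Notation leb2 := (@lebesgue_rV R d \x @lebesgue_rV R d)%E.
Variables (delta : R) (C : E * E -> R) (Om : set (E * E)).
Hypotheses (mOm : measurable Om) (Omoo : (leb2 Om < +oo)%E).
Hypothesis C2 : L2 leb2 Om C.
Implicit Types w k e : E * E -> R.

(** The maximizer over s >= delta of s (w z - C z) - s^2 / 2. *)
Definition optimal_plan w z := Num.max delta (w z - C z).

Lemma optimal_plan_L2ge w : L2 leb2 Om w ->
  L2ge leb2 Om delta (optimal_plan w).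
Proof.
move=> w2; split; first by apply: L2_maxr => //; exact: L2B.
by apply: aeW => z _; rewrite le_max lexx.
Qed.

Let V w k z := k z * w z - C z * k z - 2^-1 * k z ^+ 2.

Let integrable_V w k : L2 leb2 Om k -> L2 leb2 Om w ->
  leb2.-integrable Om (fun z => (V w k z)%:E).
Proof.
move=> k2 w2; rewrite /V; apply: integrable_subr => //.
  by apply: integrable_subr => //; exact: L2M.
by apply: integrable_scaler => //; have /(L2P _ mOm)[] := k2.
Qed.

Lemma cost_valueE w k : L2 leb2 Om k -> L2 leb2 Om w ->
  (\int[leb2]_(z in Om) (k z * w z)%:E - \int[leb2]_(z in Om) (C z * k z)%:E
     - (2^-1)%:E * sqL2norm Om k)%E = (\int[leb2]_(z in Om) V w k z)%:E.
Proof.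
move=> k2 w2; have ikw := L2M mOm k2 w2; have iCk := L2M mOm C2 k2.
have /(L2P _ mOm)[_ ikk] := k2.
rewrite /sqL2norm (integralrE _ ikw)// (integralrE _ iCk)// (integralrE _ ikk)//.
rewrite -EFinM -!EFinB; congr EFin.
rewrite RintegralB//; [|exact: integrable_subr|exact: integrable_scaler].
by rewrite RintegralB// RintegralZl.
Qed.

Lemma cost_conj_ge w : L2 leb2 Om w ->
  ((\int[leb2]_(z in Om) V w (optimal_plan w) z)%:E <= cost_conj delta C Om w)%E.
Proof.
move=> w2; have K2 := optimal_plan_L2ge w2.
apply: ereal_sup_ubound; exists (optimal_plan w) => //=.
by rewrite cost_valueE//; case: K2.
Qed.

(** Pointwise, with K the optimal plan of w and s >= delta, the gap between both sides is
    (s - K - e)^2 / 2 + (s - K) (K - (w - C)), and both terms are nonnegative. *)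
Lemma cost_conj_le w e w' : L2 leb2 Om w -> L2 leb2 Om e ->
  (forall z, w' z = w z + e z) ->
  (cost_conj delta C Om w' <=
   (\int[leb2]_(z in Om) V w (optimal_plan w) z +
    (\int[leb2]_(z in Om) (optimal_plan w z * e z) +
     2^-1 * \int[leb2]_(z in Om) (e z ^+ 2)))%:E)%E.
Proof.
move=> w2 e2 w'E; have [K2 _] := optimal_plan_L2ge w2.
have {w'E} -> : w' = (fun z => w z + e z) by exact/funext.
have iKe := L2M mOm K2 e2; have /(L2P _ mOm)[_ iee] := e2.
apply: ge_ereal_sup => _ [k [k2 kdelta] <-].
rewrite cost_valueE//; last exact: L2D.
rewrite lee_fin -RintegralZl// -RintegralD//; last exact: integrable_scaler.
rewrite -RintegralD//; last 2 first.
- exact: integrable_V.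
- by apply: integrable_addr => //; exact: integrable_scaler.
apply: ae_le_Rintegral => //.
- by apply: integrable_V => //; exact: L2D.
- apply: integrable_addr => //; first exact: integrable_V.
  by apply: integrable_addr => //; exact: integrable_scaler.
apply: filterS kdelta => z kdelta Omz; have {}kdelta := kdelta Omz.
rewrite /V /optimal_plan; move: (k z) (w z) (e z) (C z) kdelta => s b e' c0 ds.
rewrite maxEle; case: ifPn => [_|].
  by have := sqr_ge0 (s - (b - c0) - e'); rewrite -subr_ge0; lra.
rewrite -ltNge => bd; have := sqr_ge0 (s - delta - e').
have : 0 <= (s - delta) * (delta - (b - c0)) by rewrite mulr_ge0// subr_ge0// ltW.
lra.
Qed.

End cost_conjugate.

Section pearson_conjugate.
Context {R : realType} {d : nat}.
Local Notation E := 'rV[R]_d.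
Local Notation leb := (@lebesgue_rV R d).
Variables (v : E -> R) (c M : R).
Local Notation A := (esupp v).
Hypotheses (mA : measurable A) (Aoo : (leb A < +oo)%E).
Hypotheses (c_gt0 : 0 < c) (mv : measurable_fun setT v).
Hypothesis vc : {ae leb, forall x, A x -> c <= v x}.
Hypothesis vM : {ae leb, forall x, A x -> `|v x| <= M}.
Implicit Types h u e : E -> R.

Let mvA : measurable_fun A v. Proof. exact: measurable_funTS. Qed.

(** The unconstrained maximizer over s of - 2 h s - (s / v - 1)^2 v. Membership of h in the
    dual class says that it satisfies the lower bound imposed on s. *)
Definition optimal_density h x := v x * (1 - h x).

Lemma optimal_density_L2 h : L2 leb A h -> L2 leb A (optimal_density h).
Proof.
move=> h2; apply: (L2_bddM mA mvA vM); apply: L2B => //.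
exact: L2_cst.
Qed.

Let integrable_vsq h e : L2 leb A h -> L2 leb A e ->
  leb.-integrable A (fun x => (v x * (h x * e x))%:E).
Proof.
move=> h2 e2; have := L2M mA (L2_bddM mA mvA vM h2) e2.
by apply: eq_integrable => // x _; rewrite mulrA.
Qed.

Lemma measurable_pearson u : measurable_fun A u ->
  measurable_fun A (fun x => (((u x / v x - 1) ^+ 2 * v x)%:E)).
Proof.
move=> mu; apply/measurable_EFinP/measurable_funM => //.
apply/measurable_funX/measurable_funB => //.
apply: measurable_funM => //.
exact: measurableT_comp (@measurable_invr R) mvA.
Qed.

(** A Fenchel-Young inequality with a perturbation e: writing u = v (s + 1 - h), the gap is
    v (s + e)^2. For e = 0 it is the subgradient inequality at the optimal density, used on
    the primal side; with e it bounds the conjugate. *)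
Lemma pearson_ge h e u (r := fun x => u x - optimal_density h x) :
  L2 leb A h -> L2 leb A e -> measurable_fun A u ->
  leb.-integrable A (fun x => ((h x + e x) * u x)%:E) ->
  ((\int[leb]_(x in A) (v x * h x ^+ 2 - 2 * ((h x + e x) * r x)
                        - v x * e x ^+ 2))%:E <= pearson u v)%E.
Proof.
move=> h2 e2 mu iu.
have ihe : leb.-integrable A (fun x => ((h x + e x) * r x)%:E).
  have := integrable_subr mA iu (L2M mA (L2D mA h2 e2) (optimal_density_L2 h2)).
  by apply: eq_integrable => // x _; rewrite -mulrBr.
have int : leb.-integrable A (fun x => (v x * h x ^+ 2 - 2 * ((h x + e x) * r x)
                        - v x * e x ^+ 2)%:E).
  apply: integrable_subr => //; last exact: integrable_vsq.
  by apply: integrable_subr => //; [exact: integrable_vsq|exact: integrable_scaler].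
rewrite -integralrE//; apply: ae_le_integral_lower => //.
  exact: measurable_pearson.
apply: filterS vc => x vcx Ax; have {}vcx := vcx Ax.
rewrite lee_fin /r /optimal_density.
have v0 : 0 < v x by exact: lt_le_trans vcx.
(* s is the deviation of u from the optimal density, relative to v. *)
set s := (u x / v x - 1 + h x).
have -> : u x = v x * (s + 1 - h x) by rewrite /s; field; rewrite gt_eqF.
have -> : v x * (s + 1 - h x) / v x - 1 = s - h x by field; rewrite gt_eqF.
have := mulr_ge0 (ltW v0) (sqr_ge0 (s + e x)).
by move: (v x) (h x) (e x) s => a b b' s; nra.
Qed.

Lemma pearson_optimal_density h u : L2 leb A h -> measurable_fun A u ->
  {ae leb, forall x, A x -> u x = optimal_density h x} ->
  pearson u v = (\int[leb]_(x in A) (v x * h x ^+ 2))%:E.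
Proof.
move=> h2 mu uE; rewrite -integralrE//; last exact: integrable_vsq.
apply: ae_eq_integral => //.
- exact: measurable_pearson.
- exact: (measurable_int leb (integrable_vsq h2 h2)).
apply: (@filterS _ _ _ _ _ _ (filterI vc uE)) => x [vcx ux] Ax; congr EFin.
have v0 : v x != 0 by rewrite gt_eqF// (lt_le_trans c_gt0)// vcx.
by rewrite ux// /optimal_density; field.
Qed.

Lemma pearson_conj_ge theta h : L2 leb A h ->
  {ae leb, forall x, A x -> h x <= 1 - theta / v x} ->
  ((\int[leb]_(x in A) (v x * h x ^+ 2 - 2 * (v x * h x)))%:E <=
   pearson_conj theta (fun x => - 2 * h x)%R v)%E.
Proof.
move=> h2 hle; have u2 := optimal_density_L2 h2; have /(L2P _ mA)[mu _] := u2.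
apply: ereal_sup_ubound; exists (optimal_density h).
  split=> //; apply: (@filterS _ _ _ _ _ _ (filterI vc hle)) => x [vcx hx] Ax.
  have v0 : 0 < v x by rewrite (lt_le_trans c_gt0)// vcx.
  by rewrite /optimal_density mulrC -ler_pdivrMr// lerBrDl -lerBrDr hx.
rewrite (pearson_optimal_density h2 mu); last exact: aeW.
have iuh := L2M mA u2 (L2Z mA (- 2) h2).
have ivh := integrable_vsq h2 h2.
rewrite (integralrE _ iuh)// -EFinB -RintegralB//; congr EFin.
by apply: eq_Rintegral => x _; rewrite /optimal_density; ring.
Qed.

(** The integral on the first line is the value at the optimal density of h, by
    [pearson_conj_ge] a lower bound of the conjugate at - 2 h. *)
Lemma pearson_conj_le theta h e u' : L2 leb A h -> L2 leb A e ->
  (forall x, u' x = - 2 * (h x + e x)) ->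
  (pearson_conj theta u' v <=
   (\int[leb]_(x in A) (v x * h x ^+ 2 - 2 * (v x * h x)) +
    (- 2 * \int[leb]_(x in A) (optimal_density h x * e x) +
     \int[leb]_(x in A) (v x * e x ^+ 2)))%:E)%E.
Proof.
move=> h2 e2 u'E; have {u'E} -> : u' = (fun x => - 2 * (h x + e x)) by exact/funext.
apply: ge_ereal_sup => _ [u [u2 _] <-].
have he2 := L2D mA h2 e2; have o2 := optimal_density_L2 h2.
have ihe := L2M mA u2 (L2Z mA (- 2) he2).
pose r x := u x - optimal_density h x.
have r2 : L2 leb A r by exact: L2B.
have iher := L2M mA he2 r2.
have iv1 : leb.-integrable A (fun x => (v x * h x)%:E).
  by have := integrable_vsq h2 (L2_cst mA Aoo 1); apply: eq_integrable => // x _; rewrite mulr1.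
have ihh := integrable_vsq h2 h2.
have iee := integrable_vsq e2 e2.
have ioe := L2M mA o2 e2.
rewrite (integralrE _ ihe)//.
have /(L2P _ mA)[mu _] := u2.
apply: le_trans (leeB (lexx _) (pearson_ge h2 e2 mu (L2M mA he2 u2))) _.
rewrite -EFinB lee_fin -RintegralB//; last first.
  apply: integrable_subr => //; apply: integrable_subr => //.
  exact: integrable_scaler.
rewrite -RintegralZl// -RintegralD//; last exact: integrable_scaler.
rewrite -RintegralD//; last 2 first.
- by apply: integrable_subr => //; exact: integrable_scaler.
- by apply: integrable_addr => //; exact: integrable_scaler.
rewrite le_eqVlt; apply/orP; left; apply/eqP; apply: eq_Rintegral => x _.
by rewrite /r /optimal_density; ring.
Qed.

End pearson_conjugate.


(** * Square integrability of the cost *)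

Section continuous_cost.
Context {R : realType} {d : nat}.
Local Notation E := 'rV[R]_d.
Local Notation leb := (@lebesgue_rV R d).

Lemma locally_holder_continuous (V : normedModType R) (F : V -> R) :
  locally_holder F -> continuous F.
Proof.
move=> hF p; have [alpha [L [/andP[a0 a1] [U pU FU]]]] := hF p.
apply/cvgrPdist_le => eps eps0.
(* L may be negative or 0; L' is a positive constant that dominates it. *)
pose L' := `|L| + 1; have L'0 : 0 < L' by rewrite ltr_wpDl.
pose del := (eps / L') `^ alpha^-1.
have del0 : 0 < del by rewrite powR_gt0// divr_gt0.
near=> z.
have Uz : U z by near: z.
have zp : `|p - z| <= del.
  by near: z; apply: (@cvgr_dist_le _ _ _ _ _ id p) => //; exact: cvg_id.
apply: (le_trans (FU _ _ (nbhs_singleton pU) Uz)).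
apply: (@le_trans _ _ (L' * (eps / L'))); last first.
  by rewrite mulrC divfK// gt_eqF.
apply: (@le_trans _ _ (L' * `|p - z| `^ alpha)).
  by rewrite ler_wpM2r ?powR_ge0// (le_trans (ler_norm _))// lerDl.
rewrite ler_pM2l//; have -> : eps / L' = del `^ alpha.
  by rewrite /del -powRrM mulVf ?gt_eqF// powRr1// divr_ge0// ltW.
by rewrite ge0_ler_powR ?nnegrE// ltW.
Unshelve. all: by end_near. Qed.

(** The product sigma-algebra contains the open sets because those are countable unions of
    products of balls of the countable base. *)
Lemma continuous_prod_measurable (F : E * E -> R) :
  continuous F -> measurable_fun setT F.
Proof.
move=> cF; apply: (measurability _ (RGenOpens.measurableE R)).
move=> _ [_ [a [b ->] <-]]; rewrite setTI.
set U := F @^-1` _; have oU : open U.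
  by move/continuousP : cF; apply; exact: interval_open.
rewrite (_ : U = \bigcup_n \bigcup_(m in [set m |
    rat_ball n `*` rat_ball m `<=` U]) (rat_ball n `*` rat_ball m)).
  apply: bigcup_measurable => n _; apply: bigcup_measurable => m _.
  by apply: measurableX; exact: rat_ball_measurable.
apply/seteqP; split=> [[x y] Uxy|z [n _ [m nmU nmz]]]; last exact: nmU.
have [[V W] /= [xV yW] VWU] := open_nbhs_nbhs (conj oU Uxy).
have [n [nx nV]] := rat_ball_basis (@open_interior _ V) xV.
have [m [my mW]] := rat_ball_basis (@open_interior _ W) yW.
exists n => //; exists m => //= -[x' y'] [/= nx' my']; apply: VWU; split.
  by apply: interior_subset; exact: nV.
by apply: interior_subset; exact: mW.
Qed.

Lemma continuous_prod_L2 (F : E * E -> R) (A B : set E) :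
  continuous F -> compact A -> compact B ->
  L2 (leb \x leb)%E (A `*` B) F.
Proof.
move=> cF cA cB.
have mA := compact_rV_measurable cA; have mB := compact_rV_measurable cB.
have [M [_ FM]] : [bounded F z | z in A `*` B].
  have cFAB := continuous_compact (continuous_subspaceT cF) (compact_setX cA cB).
  have [M [Mr MF]] := compact_bounded cFAB.
  by exists M; split=> // N MN z ABz; apply: (MF N MN); exists z.
have ABoo : ((leb \x leb)%E (A `*` B) < +oo)%E.
  by rewrite product_measure1E// lte_mul_pinfty ?ge0_fin_numE// compact_rV_lty.
apply: (L2_bounded (measurableX mA mB) ABoo (M := M + 1)).
- by apply: measurable_funTS; exact: continuous_prod_measurable.
- by apply: aeW => z ABz; apply: FM => //; rewrite ltrDl.
Qed.

End continuous_cost.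

(** * Optimality conditions *)

Lemma linear_quadratic_ge0 (R : realFieldType) (p q : R) :
  (forall eps, 0 <= eps * p + eps ^+ 2 * q) -> p = 0.
Proof.
(* eps = - p / q' makes the expression equal to p^2 / q'^2 (q - q'). *)
move=> pq; pose q' := `|q| + 1; have q'0 : 0 < q' by rewrite ltr_wpDl.
have := pq (- p / q').
have -> : - p / q' * p + (- p / q') ^+ 2 * q = p ^+ 2 / q' ^+ 2 * (q - q').
  by field; rewrite gt_eqF.
have qq' : q - q' < 0 by rewrite subr_lt0 (le_lt_trans (ler_norm q))// ltrDl.
rewrite nmulr_lge0// => h; have : p ^+ 2 / q' ^+ 2 = 0.
  by apply/eqP; rewrite eq_le h divr_ge0 ?sqr_ge0.
by move/eqP; rewrite mulf_eq0 invr_eq0 !sqrf_eq0 (gt_eqF q'0) orbF => /eqP.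
Qed.

Section optimality.
Context {R : realType} {d : nat}.
Local Notation E := 'rV[R]_d.
Local Notation leb := (@lebesgue_rV R d).
Local Notation leb2 := (leb \x leb)%E.
Variables (delta c M : R) (C : E * E -> R) (f g k1 k2 : E -> R).
Local Notation Of := (esupp f).
Local Notation Og := (esupp g).
Local Notation Om := (Of `*` Og).
Hypothesis c_gt0 : 0 < c.
Hypotheses (mf : measurable_fun setT f) (mg : measurable_fun setT g).
Hypotheses (cOf : compact Of) (cOg : compact Og).
Hypothesis f_ge : {ae leb, forall x, Of x -> c <= f x}.
Hypothesis g_ge : {ae leb, forall x, Og x -> c <= g x}.
Hypothesis f_le : {ae leb, forall x, Of x -> `|f x| <= M}.
Hypothesis g_le : {ae leb, forall x, Og x -> `|g x| <= M}.
Hypothesis C2 : L2 leb2 Om C.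
Hypotheses (k1_class : dual_class delta f g k1) (k2_class : dual_class delta g f k2).
Hypothesis k12_min : minimizer (L2 leb Of `*` L2 leb Og) (dual delta C f g) (k1, k2).

Let mOf : measurable Of. Proof. exact: compact_rV_measurable. Qed.
Let mOg : measurable Og. Proof. exact: compact_rV_measurable. Qed.
Let mOm : measurable Om. Proof. exact: measurableX. Qed.
Let Ofoo : (leb Of < +oo)%E. Proof. exact: compact_rV_lty. Qed.
Let Ogoo : (leb Og < +oo)%E. Proof. exact: compact_rV_lty. Qed.
Let Omoo : (leb2 Om < +oo)%E.
Proof. by rewrite product_measure1E// lte_mul_pinfty ?ge0_fin_numE. Qed.

Let tensor_L2 (e1 e2 : E -> R) : L2 leb Of e1 -> L2 leb Og e2 ->
  L2 leb2 Om (fun z => e1 z.1 + e2 z.2).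
Proof.
by move=> he1 he2; apply: L2D => //; [exact: L2_fst|exact: L2_snd].
Qed.

Let k1_L2 : L2 leb Of k1. Proof. by case: k1_class. Qed.
Let k2_L2 : L2 leb Og k2. Proof. by case: k2_class. Qed.

Let w z := k1 z.1 + k2 z.2.
Let w_L2 : L2 leb2 Om w. Proof. exact: tensor_L2. Qed.

Let K := optimal_plan delta C w.
Let K_L2 : L2 leb2 Om K.
Proof. by have [] := optimal_plan_L2ge delta mOm Omoo C2 w_L2. Qed.

(** The derivative of the dual functional vanishes at (k1, k2). Along a line the dual values
    are bounded below by the value at the base point and above by a quadratic polynomial in
    eps with the same constant term; the linear coefficient is the difference of both
    sides. *)
Lemma dual_stationary (e1 e2 : E -> R) : L2 leb Of e1 -> L2 leb Og e2 ->
  \int[leb2]_(z in Om) (K z * (e1 z.1 + e2 z.2)) =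
  \int[leb]_(x in Of) (optimal_density f k1 x * e1 x) +
  \int[leb]_(y in Og) (optimal_density g k2 y * e2 y).
Proof.
move=> he1 he2; have he := tensor_L2 he1 he2.
apply/eqP; rewrite -subr_eq0; apply/eqP.
pose I1 := 2^-1 * \int[leb2]_(z in Om) ((e1 z.1 + e2 z.2) ^+ 2).
pose I2 := 2^-1 * \int[leb]_(x in Of) (f x * e1 x ^+ 2).
pose I3 := 2^-1 * \int[leb]_(y in Og) (g y * e2 y ^+ 2).
apply: (@linear_quadratic_ge0 _ _ (I1 + I2 + I3)) => eps.
have [_ /(_ (fun x => k1 x + eps * e1 x, fun y => k2 y + eps * e2 y))] := k12_min.
have he1' : L2 leb Of (fun x => eps * e1 x) by exact: L2Z.
have he2' : L2 leb Og (fun y => eps * e2 y) by exact: L2Z.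
have he' := tensor_L2 he1' he2'.
move=> /(_ (conj (L2D mOf k1_L2 he1') (L2D mOg k2_L2 he2'))).
rewrite /dual/= => le_dual.
have cg := cost_conj_ge delta mOm Omoo C2 w_L2.
have cl := cost_conj_le delta mOm Omoo C2 w_L2 he'
  (w' := fun z => (k1 z.1 + eps * e1 z.1 + (k2 z.2 + eps * e2 z.2))%R)
  (fun z => addrACA _ _ _ _).
have fg := pearson_conj_ge mOf Ofoo c_gt0 mf f_ge f_le k1_L2 (proj2 k1_class).
have fl := pearson_conj_le mOf Ofoo c_gt0 mf f_ge f_le (delta * volume Og) k1_L2 he1'
  (u' := fun x => - 2 * (k1 x + eps * e1 x)) (fun x => erefl).
have gg := pearson_conj_ge mOg Ogoo c_gt0 mg g_ge g_le k2_L2 (proj2 k2_class).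
have gl := pearson_conj_le mOg Ogoo c_gt0 mg g_ge g_le (delta * volume Of) k2_L2 he2'
  (u' := fun x => - 2 * (k2 x + eps * e2 x)) (fun x => erefl).
have half0 : (0 <= (2^-1 : R)%:E)%E by rewrite lee_fin invr_ge0.
have := le_trans (leeD (leeD cg (lee_wpmul2l half0 fg)) (lee_wpmul2l half0 gg)) 
  (le_trans le_dual (leeD (leeD cl (lee_wpmul2l half0 fl)) (lee_wpmul2l half0 gl))).
rewrite -!EFinM -!EFinD lee_fin.
have /(L2P _ mOm)[_ iee] := he.
have i1 := L2M mOf (L2_bddM mOf (measurable_funTS mf) f_le he1) he1.
have i2 := L2M mOg (L2_bddM mOg (measurable_funTS mg) g_le he2) he2.
have iK := L2M mOm K_L2 he.
have o1 := L2M mOf (optimal_density_L2 mOf Ofoo mf f_le k1_L2) he1.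
have o2 := L2M mOg (optimal_density_L2 mOg Ogoo mg g_le k2_L2) he2.
have -> : \int[leb2]_(z in Om) (optimal_plan delta C w z * (eps * e1 z.1 + eps * e2 z.2)) =
    eps * \int[leb2]_(z in Om) (K z * (e1 z.1 + e2 z.2)).
  by rewrite -RintegralZl//; apply: eq_Rintegral => z _; rewrite /K; ring.
have -> : \int[leb2]_(z in Om) (eps * e1 z.1 + eps * e2 z.2) ^+ 2 =
    eps ^+ 2 * \int[leb2]_(z in Om) ((e1 z.1 + e2 z.2) ^+ 2).
  by rewrite -RintegralZl//; apply: eq_Rintegral => z _; ring.
have -> : \int[leb]_(x in Of) (optimal_density f k1 x * (eps * e1 x)) =
    eps * \int[leb]_(x in Of) (optimal_density f k1 x * e1 x).
  by rewrite -RintegralZl//; apply: eq_Rintegral => z _; ring.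
have -> : \int[leb]_(x in Og) (optimal_density g k2 x * (eps * e2 x)) =
    eps * \int[leb]_(x in Og) (optimal_density g k2 x * e2 x).
  by rewrite -RintegralZl//; apply: eq_Rintegral => z _; ring.
have -> : \int[leb]_(x in Of) (f x * (eps * e1 x) ^+ 2) =
    eps ^+ 2 * \int[leb]_(x in Of) (f x * e1 x ^+ 2).
  rewrite -RintegralZl//; first by apply: eq_Rintegral => z _; ring.
  by apply: eq_integrable i1 => // z _; rewrite /= expr2 mulrA.
have -> : \int[leb]_(x in Og) (g x * (eps * e2 x) ^+ 2) =
    eps ^+ 2 * \int[leb]_(x in Og) (g x * e2 x ^+ 2).
  rewrite -RintegralZl//; first by apply: eq_Rintegral => z _; ring.
  by apply: eq_integrable i2 => // z _; rewrite /= expr2 mulrA.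
rewrite /I1 /I2 /I3; clear I1 I2 I3; lra.
Qed.

Lemma marginal_x_stationary (psi : E -> R) : L2 leb Of psi ->
  \int[leb]_(x in Of) (marginal_x g K x * psi x) =
  \int[leb]_(x in Of) (optimal_density f k1 x * psi x).
Proof.
move=> hpsi; have /(L2P _ mOf)[mpsi _] := hpsi.
have h0 := L2_cst mOg Ogoo 0.
have [_ <-] := marginal1P mOf mOg mpsi (L2_integrable mOm Omoo K_L2)
  (L2M mOm K_L2 (L2_fst mOf mOg Ogoo hpsi)).
have := dual_stationary hpsi h0.
rewrite (_ : \int[leb]_(y in Og) _ = 0) ?addr0.
  by move=> <-; apply: eq_Rintegral => z _; rewrite addr0.
by rewrite /Rintegral integral0_eq// => y _; rewrite mulr0.
Qed.

Lemma marginal_y_stationary (psi : E -> R) : L2 leb Og psi ->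
  \int[leb]_(y in Og) (marginal_y f K y * psi y) =
  \int[leb]_(y in Og) (optimal_density g k2 y * psi y).
Proof.
move=> hpsi; have /(L2P _ mOg)[mpsi _] := hpsi.
have h0 := L2_cst mOf Ofoo 0.
have [_ <-] := marginal2P mOf mOg mpsi (L2_integrable mOm Omoo K_L2)
  (L2M mOm K_L2 (L2_snd mOf mOg Ofoo hpsi)).
have := dual_stationary h0 hpsi.
rewrite (_ : \int[leb]_(x in Of) _ = 0) ?add0r.
  by move=> <-; apply: eq_Rintegral => z _; rewrite add0r.
by rewrite /Rintegral integral0_eq// => y _; rewrite mulr0.
Qed.

(** Testing against indicator functions of measurable subsets. *)
Let ae_eq_tested (A : set E) (u v : E -> R) : measurable A -> (leb A < +oo)%E ->
  measurable_fun A v -> leb.-integrable A (fun x => (u x)%:E) ->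
  (forall psi, L2 leb A psi ->
    leb.-integrable A (fun x => (v x * psi x)%:E) /\
    \int[leb]_(x in A) (v x * psi x) = \int[leb]_(x in A) (u x * psi x)) ->
  {ae leb, forall x, A x -> v x = u x}.
Proof.
move=> mA Aoo mv iu uv.
have : ae_eq leb A (EFin \o u) (EFin \o v).
  apply: integral_ae_eq => //; first exact/measurable_EFinP.
  move=> S SA mS; have S2 : L2 leb A (\1_S : E -> R).
    apply: (L2_bounded mA Aoo (M := 1)); first exact: measurable_indic.
    by apply: aeW => x _; rewrite indicE normr_nat; case: (_ \in _).
  have [iv vu] := uv _ S2.
  have iuS : leb.-integrable A (fun x => (u x * (\1_S : E -> R) x)%:E).
    have /(integrable_mkcond _ mS)h := integrableS mA mS SA iu.
    apply: (integrableS measurableT) => //; apply: eq_integrable h => // x _.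
    by rewrite patchE indicE; case: ifP; rewrite ?mulr1 ?mulr0.
  have SE (t : E -> R) : (\int[leb]_(x in S) (EFin \o t) x =
      \int[leb]_(x in A) (t x * (\1_S : E -> R) x)%:E)%E.
    rewrite -[in LHS](setIidl SA) integral_mkcondl; apply: eq_integral => x _.
    by rewrite patchE indicE; case: ifP => /=; rewrite ?mulr1 ?mulr0.
  by rewrite !SE (integralrE _ iuS)// (integralrE _ iv)// vu.
by apply: filterS => x uvx Ax; have [] := uvx Ax.
Qed.

Lemma marginal_x_optimal :
  {ae leb, forall x, Of x -> marginal_x g K x = optimal_density f k1 x}.
Proof.
have iK := L2_integrable mOm Omoo K_L2.
apply: ae_eq_tested => //; first exact: (measurable_marginal1 mOf mOg iK).
  by apply: L2_integrable => //; exact: (optimal_density_L2 mOf Ofoo mf f_le k1_L2).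
move=> psi hpsi; split; last exact: marginal_x_stationary.
have /(L2P _ mOf)[mpsi _] := hpsi.
by have [] := marginal1P mOf mOg mpsi iK (L2M mOm K_L2 (L2_fst mOf mOg Ogoo hpsi)).
Qed.

Lemma marginal_y_optimal :
  {ae leb, forall y, Og y -> marginal_y f K y = optimal_density g k2 y}.
Proof.
have iK := L2_integrable mOm Omoo K_L2.
apply: ae_eq_tested => //; first exact: (measurable_marginal2 mOf mOg iK).
  by apply: L2_integrable => //; exact: (optimal_density_L2 mOg Ogoo mg g_le k2_L2).
move=> psi hpsi; split; last exact: marginal_y_stationary.
have /(L2P _ mOg)[mpsi _] := hpsi.
by have [] := marginal2P mOf mOg mpsi iK (L2M mOm K_L2 (L2_snd mOf mOg Ofoo hpsi)).
Qed.

Variable k : E * E -> R.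
Hypothesis k_min : minimizer (L2ge leb2 Om delta) (primal C f g) k.

Let k_L2 : L2 leb2 Om k. Proof. by case: k_min => -[]. Qed.
Let k_ge : {ae leb2, forall z, Om z -> delta <= k z}.
Proof. by case: k_min => -[]. Qed.

Lemma primal_optimal_plan :
  primal C f g K =
  (\int[leb2]_(z in Om) (C z * K z) + 2^-1 * \int[leb2]_(z in Om) (K z ^+ 2)
   + 2^-1 * \int[leb]_(x in Of) (f x * k1 x ^+ 2)
   + 2^-1 * \int[leb]_(y in Og) (g y * k2 y ^+ 2))%:E.
Proof.
have iK := L2_integrable mOm Omoo K_L2; have iCK := L2M mOm C2 K_L2.
have /(L2P _ mOm)[_ iKK] := K_L2.
rewrite /primal /sqL2norm (integralrE _ iCK)// (integralrE _ iKK)//.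
rewrite (pearson_optimal_density mOf c_gt0 mf f_ge f_le k1_L2
  (measurable_marginal1 mOf mOg iK) marginal_x_optimal).
rewrite (pearson_optimal_density mOg c_gt0 mg g_ge g_le k2_L2
  (measurable_marginal2 mOf mOg iK) marginal_y_optimal).
by rewrite -!EFinM -!EFinD.
Qed.

(** The two divergences are bounded below by their subgradient inequality at the marginals
    of K; by [dual_stationary] the linear terms add up to the integral of (k - K) w. *)
Lemma primal_ge : 
  ((\int[leb2]_(z in Om) (C z * k z) + 2^-1 * \int[leb2]_(z in Om) (k z ^+ 2)
   + 2^-1 * \int[leb]_(x in Of) (f x * k1 x ^+ 2)
   + 2^-1 * \int[leb]_(y in Og) (g y * k2 y ^+ 2)
   + \int[leb2]_(z in Om) (K z * w z) - \int[leb2]_(z in Om) (k z * w z))%:E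
   <= primal C f g k)%E.
Proof.
have ik := L2_integrable mOm Omoo k_L2; have iCk := L2M mOm C2 k_L2.
have /(L2P _ mOm)[_ ikk] := k_L2.
have /(L2P _ mOf)[mk1 _] := k1_L2; have /(L2P _ mOg)[mk2 _] := k2_L2.
have L1 := L2_fst mOf mOg Ogoo k1_L2; have L2' := L2_snd mOf mOg Ofoo k2_L2.
have [ix xE] := marginal1P mOf mOg mk1 ik (L2M mOm k_L2 L1).
have [iy yE] := marginal2P mOf mOg mk2 ik (L2M mOm k_L2 L2').
have ikw := L2M mOm k_L2 w_L2.
have Z1 := L2_cst mOf Ofoo 0; have Z2 := L2_cst mOg Ogoo 0.
have px := pearson_ge mOf Ofoo c_gt0 mf f_ge f_le k1_L2 Z1
  (measurable_marginal1 mOf mOg ik).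
have py := pearson_ge mOg Ogoo c_gt0 mg g_ge g_le k2_L2 Z2
  (measurable_marginal2 mOf mOg ik).
rewrite /primal /sqL2norm (integralrE _ iCk)// (integralrE _ ikk)//.
have half0 : (0 <= (2^-1 : R)%:E)%E by rewrite lee_fin invr_ge0.
have ix' : leb.-integrable Of (fun x => ((k1 x + cst 0 x) * marginal_x g k x)%:E).
  by apply: eq_integrable ix => // x _; rewrite /= addr0 mulrC.
have iy' : leb.-integrable Og (fun y => ((k2 y + cst 0 y) * marginal_y f k y)%:E).
  by apply: eq_integrable iy => // y _; rewrite /= addr0 mulrC.
have {}px := px ix'; have {}py := py iy'.
apply: le_trans (leeD (leeD (lexx _) (lee_wpmul2l half0 px)) (lee_wpmul2l half0 py)).
rewrite -!EFinM -!EFinD lee_fin.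
have sf := L2M mOf (L2_bddM mOf (measurable_funTS mf) f_le k1_L2) k1_L2.
have sg := L2M mOg (L2_bddM mOg (measurable_funTS mg) g_le k2_L2) k2_L2.
have o1 := L2M mOf (optimal_density_L2 mOf Ofoo mf f_le k1_L2) k1_L2.
have o2 := L2M mOg (optimal_density_L2 mOg Ogoo mg g_le k2_L2) k2_L2.
have -> : \int[leb]_(x in Of) (f x * k1 x ^+ 2 - 2 * ((k1 x + cst 0 x) *
      (marginal_x g k x - optimal_density f k1 x)) - f x * cst 0 x ^+ 2) =
    \int[leb]_(x in Of) (f x * k1 x ^+ 2) - 2 * 
     (\int[leb]_(x in Of) (marginal_x g k x * k1 x) -
      \int[leb]_(x in Of) (optimal_density f k1 x * k1 x)).
  have sf' : leb.-integrable Of (fun x => (f x * k1 x ^+ 2)%:E).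
    by apply: eq_integrable sf => // x _; rewrite /= expr2 mulrA.
  rewrite -RintegralB// -RintegralZl//; last exact: integrable_subr.
  rewrite -RintegralB//; last by apply: integrable_scaler => //; exact: integrable_subr.
  by apply: eq_Rintegral => x _ /=; ring.
have -> : \int[leb]_(y in Og) (g y * k2 y ^+ 2 - 2 * ((k2 y + cst 0 y) *
      (marginal_y f k y - optimal_density g k2 y)) - g y * cst 0 y ^+ 2) =
    \int[leb]_(y in Og) (g y * k2 y ^+ 2) - 2 * 
     (\int[leb]_(y in Og) (marginal_y f k y * k2 y) -
      \int[leb]_(y in Og) (optimal_density g k2 y * k2 y)).
  have sg' : leb.-integrable Og (fun x => (g x * k2 x ^+ 2)%:E).
    by apply: eq_integrable sg => // x _; rewrite /= expr2 mulrA.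
  rewrite -RintegralB// -RintegralZl//; last exact: integrable_subr.
  rewrite -RintegralB//; last by apply: integrable_scaler => //; exact: integrable_subr.
  by apply: eq_Rintegral => x _ /=; ring.
have := dual_stationary k1_L2 k2_L2.
have -> : \int[leb2]_(z in Om) (k z * w z) =
    \int[leb]_(x in Of) (marginal_x g k x * k1 x) +
    \int[leb]_(y in Og) (marginal_y f k y * k2 y).
  rewrite -xE -yE -RintegralD//; [|exact: (L2M mOm k_L2)..].
  by apply: eq_Rintegral => z _; rewrite /w mulrDr.
rewrite -/w; lra.
Qed.

(** Where K > delta one has C + K = w, and where K = delta one has C + K >= w and k >= K.
    Hence (C + K - w) (k - K) >= 0, and the primal value of k exceeds that of K by at least
    half the integral of (k - K)^2. *)
Lemma primal_minimizerE : {ae leb2, forall z, Om z -> k z = K z}.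
Proof.
have [_ /(_ K (optimal_plan_L2ge delta mOm Omoo C2 w_L2))] := k_min.
rewrite primal_optimal_plan => /(le_trans primal_ge); rewrite lee_fin => le_kK.
have kK := L2B mOm k_L2 K_L2; have /(L2P _ mOm)[mkK ikK] := kK.
have : {ae leb2, forall z, Om z -> k z - K z = 0}.
  apply: Rintegral_sqr_eq0 => //.
  have iCk := L2M mOm C2 k_L2; have iCK := L2M mOm C2 K_L2.
  have /(L2P _ mOm)[_ ikk] := k_L2; have /(L2P _ mOm)[_ iKK] := K_L2.
  have ikw := L2M mOm k_L2 w_L2; have iKw := L2M mOm K_L2 w_L2.
  have i1 := integrable_scaler mOm 2 (integrable_subr mOm iCk iCK).
  have i2 := integrable_subr mOm ikk iKK.
  have i3 := integrable_scaler mOm 2 (integrable_subr mOm iKw ikw).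
  apply: (@le_trans _ _ (\int[leb2]_(z in Om) (2 * (C z * k z - C z * K z) +
      (k z ^+ 2 - K z ^+ 2) + 2 * (K z * w z - k z * w z)))).
    apply: ae_le_Rintegral => //.
      by apply: integrable_addr => //; exact: integrable_addr.
    apply: filterS k_ge => z kz Omz; have {kz} := kz Omz.
    rewrite /K /optimal_plan; move: (C z) (k z) (w z) => a s b ds.
    rewrite maxEle; case: ifPn => [_|]; first lra.
    rewrite -ltNge => bd.
    have : 0 <= (s - delta) * (delta - (b - a)) by rewrite mulr_ge0// subr_ge0// ltW.
    lra.
  rewrite RintegralD//; last exact: integrable_addr.
  rewrite RintegralD// !RintegralZl//; [|exact: integrable_subr..].
  rewrite !RintegralB//; lra.
by apply: filterS => z kKz Omz; apply/eqP; rewrite -subr_eq0 kKz.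
Qed.

(** The equality k = K holds almost everywhere on the product, so it is transferred to the
    marginals through test functions. *)
Lemma minimizer_marginal_x :
  {ae leb, forall x, Of x -> marginal_x g k x = optimal_density f k1 x}.
Proof.
have ik := L2_integrable mOm Omoo k_L2.
apply: ae_eq_tested => //; first exact: (measurable_marginal1 mOf mOg ik).
  by apply: L2_integrable => //; exact: (optimal_density_L2 mOf Ofoo mf f_le k1_L2).
move=> psi hpsi; have /(L2P _ mOf)[mpsi _] := hpsi.
have psi1 := L2_fst mOf mOg Ogoo hpsi.
have [ix xE] := marginal1P mOf mOg mpsi ik (L2M mOm k_L2 psi1).
split=> //; rewrite -marginal_x_stationary//.
have [_ <-] := marginal1P mOf mOg mpsi (L2_integrable mOm Omoo K_L2)
  (L2M mOm K_L2 psi1).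
rewrite -[LHS]xE; apply: ae_eq_Rintegral => //; [exact: (L2M mOm _ psi1)..|].
by apply: filterS primal_minimizerE => z kK Omz; rewrite kK.
Qed.

Lemma minimizer_marginal_y :
  {ae leb, forall y, Og y -> marginal_y f k y = optimal_density g k2 y}.
Proof.
have ik := L2_integrable mOm Omoo k_L2.
apply: ae_eq_tested => //; first exact: (measurable_marginal2 mOf mOg ik).
  by apply: L2_integrable => //; exact: (optimal_density_L2 mOg Ogoo mg g_le k2_L2).
move=> psi hpsi; have /(L2P _ mOg)[mpsi _] := hpsi.
have psi2 := L2_snd mOf mOg Ofoo hpsi.
have [iy yE] := marginal2P mOf mOg mpsi ik (L2M mOm k_L2 psi2).
split=> //; rewrite -marginal_y_stationary//.
have [_ <-] := marginal2P mOf mOg mpsi (L2_integrable mOm Omoo K_L2)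
  (L2M mOm K_L2 psi2).
rewrite -[LHS]yE; apply: ae_eq_Rintegral => //; [exact: (L2M mOm _ psi2)..|].
by apply: filterS primal_minimizerE => z kK Omz; rewrite kK.
Qed.

End optimality.


(** * Gradients of convex functions *)

Section convex_gradient.
Context {R : realType} {d : nat}.
Local Notation E := 'rV[R]_d.
Implicit Types (x y u v : E) (phi : E -> R).

Lemma dotrvDl u v x : dotrv (u + v) x = dotrv u x + dotrv v x.
Proof. by rewrite /dotrv -big_split; apply: eq_bigr => i _; rewrite mxE mulrDl. Qed.

Lemma dotrvZl a u x : dotrv (a *: u) x = a * dotrv u x.
Proof. by rewrite /dotrv big_distrr; apply: eq_bigr => i _; rewrite mxE /= mulrA. Qed.

Lemma dotrvC u v : dotrv u v = dotrv v u.
Proof. by apply: eq_bigr => i _; rewrite mulrC. Qed.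

Lemma dotrvZr a x u : dotrv x (a *: u) = a * dotrv x u.
Proof. by rewrite dotrvC dotrvZl (dotrvC x). Qed.

Lemma dotrvBl u v x : dotrv (u - v) x = dotrv u x - dotrv v x.
Proof. by rewrite dotrvDl -scaleN1r dotrvZl mulN1r. Qed.

Lemma dotrvBr x u v : dotrv x (u - v) = dotrv x u - dotrv x v.
Proof. by rewrite dotrvC dotrvBl !(dotrvC x). Qed.

(** The constant d appears because the norm on row vectors is the sup norm. *)
Lemma dotrv_le u v : `|dotrv u v| <= d%:R * (`|u| * `|v|).
Proof.
rewrite (le_trans (ler_norm_sum _ _ _))//.
apply: (@le_trans _ _ (\sum_(i < d) `|u| * `|v|)).
  by apply: ler_sum => i _; rewrite normrM ler_pM// coord_le_norm.
by rewrite sumr_const card_ord mulr_natl.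
Qed.

Lemma norm_sqr_le_dotrv u : `|u| ^+ 2 <= dotrv u u.
Proof.
have duu : 0 <= dotrv u u by apply: sumr_ge0 => i _; rewrite -expr2 sqr_ge0.
rewrite -[leRHS]sqr_sqrtr// ler_sqr ?nnegrE ?sqrtr_ge0//.
rewrite [leLHS]/Num.norm /= mx_normrE.
apply/bigmax_leP; split=> [|[i j] _ /=]; first exact: sqrtr_ge0.
rewrite ord1 -sqrtr_sqr ler_wsqrtr// /dotrv (bigD1 j)//= -expr2 lerDl.
by apply: sumr_ge0 => l _; rewrite -expr2 sqr_ge0.
Qed.

Lemma derive_dotrv phi x v : differentiable phi x ->
  'D_v phi x = dotrv (grad phi x) v.
Proof.
move=> dphi; rewrite deriveE// {1}(row_sum_delta v) linear_sum.
by apply: eq_bigr => i _; rewrite linearZ /= mxE deriveE// mulrC.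
Qed.

(** The difference quotients along the segment from x to y are bounded by phi y - phi x;
    their limit at 0 is the directional derivative. *)
Lemma convex_gradient_le (A : set E) phi x y : convex_function A phi ->
  A x -> A y -> differentiable phi x ->
  dotrv (grad phi x) (y - x) <= phi y - phi x.
Proof.
move=> cphi Ax Ay dx; rewrite -derive_dotrv//.
have dv := @diff_derivable _ _ _ _ _ (y - x) dx.
have /cvg_dnbhs_at_right cv := dv.
apply: (cvgr_to_le cv); near=> t.
have t0 : 0 < t by near: t; exact: nbhs_right_gt.
have t1 : t <= 1 by near: t; exact: nbhs_right_le.
pose l := Itv01 (ltW t0) t1.
have : phi (t *: y + (1 - t) *: x) <= t * phi y + (1 - t) * phi x.
  exact: (cphi l y x (mem_set Ay) (mem_set Ax)).
move=> le_conv.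
rewrite -[_ *: _]/(_ * _) mulrC ler_pdivrMr//=.
have -> : t *: (y - x) + x = t *: y + (1 - t) *: x.
  by rewrite scalerBr scalerBl scale1r addrA addrAC -addrA addrC -addrA.
rewrite lerBlDr (le_trans le_conv)//; lra.
Unshelve. all: by end_near. Qed.

Section domain.
Variables (A : set E) (Phi : E -> R).
Hypothesis cPhi : convex_function A Phi.
Local Notation D := (grad_domain A Phi).

Lemma gradient_monotone x y : D x -> D y ->
  0 <= dotrv (grad Phi x - grad Phi y) (x - y).
Proof.
move=> [Ax dx] [Ay dy]; have {}Ax := interior_subset Ax.
have {}Ay := interior_subset Ay.
have := convex_gradient_le cPhi Ax Ay dx; have := convex_gradient_le cPhi Ay Ax dy.
rewrite dotrvBl -(opprB x y) -(scaleN1r (x - y)) dotrvZr; lra.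
Qed.

(** Pairing the difference of the images with x - y, the gradient part contributes a
    nonnegative term by monotonicity. *)
Lemma interpolation_expansive (T t : R) x y : 0 < T -> 0 < t < T -> D x -> D y ->
  (T - t) / T * `|x - y| <=
  d%:R * `|interpolation T Phi t x - interpolation T Phi t y|.
Proof.
move=> T0 /andP[t0 tT] Dx Dy; set s := interpolation _ _ _ _ - _.
have [->|xy0] := eqVneq x y; first by rewrite subrr normr0 mulr0 mulr_ge0.
have nxy : 0 < `|x - y| by rewrite normr_gt0 subr_eq0.
rewrite -(ler_pM2r nxy).
have -> : d%:R * `|s| * `|x - y| = d%:R * (`|s| * `|x - y|) by rewrite mulrA.
apply: le_trans (le_trans (ler_norm _) (dotrv_le s (x - y))).
have -> : s = ((T - t) / T) *: (x - y) + (t / T) *: (grad Phi x - grad Phi y).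
  by rewrite /s /interpolation !scalerBr opprD addrACA.
rewrite dotrvDl !dotrvZl; have := gradient_monotone Dx Dy.
have := norm_sqr_le_dotrv (x - y).
have a0 : 0 <= (T - t) / T by rewrite divr_ge0// ?subr_ge0 ltW.
have b0 : 0 <= t / T by rewrite divr_ge0// ltW.
move: (_ / T) (_ / T) (dotrv _ _) (dotrv _ _) `|x - y| a0 b0 => a b p q r a0 b0 rp q0.
by have := mulr_ge0 b0 q0; have := ler_wpM2l a0 rp; lra.
Qed.

Lemma interpolation_inj (T t : R) : 0 < T -> 0 < t < T ->
  {in D &, injective (interpolation T Phi t)}.
Proof.
move=> T0 tT x y /set_mem Dx /set_mem Dy Txy.
have := interpolation_expansive T0 tT Dx Dy.
rewrite Txy subrr normr0 mulr0 pmulr_rle0; last first.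
  by case/andP: tT => _ tT; rewrite divr_gt0// subr_gt0.
by rewrite normr_le0 subr_eq0 => /eqP.
Qed.

(** At an interior point the pairing of a subgradient with v is at most the derivative in
    direction v; applying this to v and to - v gives equality. *)
Lemma subgradient_unique x p : D x ->
  (forall y, A y -> dotrv p (y - x) <= Phi y - Phi x) -> p = grad Phi x.
Proof.
move=> [Ax dx] pA; have {Ax} /nbhs_ballP[e /= e0 xeA] := Ax.
have le_p v : dotrv p v <= dotrv (grad Phi x) v.
  rewrite -derive_dotrv//; have dv := @diff_derivable _ _ _ _ _ v dx.
  have /cvg_dnbhs_at_right cv := dv.
  apply: (cvgr_to_ge cv); near=> t.
  have t0 : 0 < t by near: t; exact: nbhs_right_gt.
  rewrite -[_ *: _]/(_ * _) mulrC ler_pdivlMr//= mulrC -dotrvZr.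
  have -> : t *: v = t *: v + x - x by rewrite addrK.
  rewrite subrK pA//; apply: xeA; rewrite -ball_normE/= opprD addrCA subrr addr0.
  rewrite normrN normrZ gtr0_norm//.
  have v1 : 0 < `|v| + 1 by rewrite ltr_wpDl.
  apply: (@lt_le_trans _ _ (t * (`|v| + 1))); first by rewrite ltr_pM2l// ltrDl.
  rewrite -ler_pdivlMr//; near: t; apply: nbhs_right_le.
  by rewrite divr_gt0.
apply/rowP => i; have := le_p (delta_mx ord0 i); have := le_p (- delta_mx ord0 i).
have dd (q : E) : dotrv q (delta_mx ord0 i) = q ord0 i.
  rewrite /dotrv (bigD1 i)//= big1 ?addr0 ?mxE ?eqxx ?mulr1//.
  by move=> j /negPf ji; rewrite mxE ji andbF mulr0.
rewrite -scaleN1r !dotrvZr !dd => h1 h2; apply/eqP; rewrite eq_le h2/=.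
by move: h1; rewrite !mulN1r lerN2.
Unshelve. all: by end_near. Qed.

(** Gradients at points of G tending to x have a cluster point p in the compact set B. The
    subgradient inequality passes to the limit, so p is a subgradient at x, and
    differentiability at x forces it to be the gradient. *)
Lemma gradient_closure (B G : set E) x : compact B -> G `<=` D ->
  (forall y, G y -> B (grad Phi y)) -> D x -> closure G x -> B (grad Phi x).
Proof.
move=> cB GD GB Dx clG; have [Ax dx] := Dx.
have FF : ProperFilter (within G (nbhs x)) by exact: within_nbhs_proper.
have BF : (grad Phi @ within G (nbhs x)) B.
  by apply: (@filterS _ (within G (nbhs x)) _ G); [exact: GB|exact: withinT].
have [p [Bp clp]] := cB _ (fmap_proper_filter (grad Phi) FF) BF.
rewrite -(@subgradient_unique x p)// => y Ay.
apply/ler_addgt0Pr => e e0.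
(* K bounds the Lipschitz constant of the error terms in x' and in its gradient, for x'
   at distance at most 1 from x. *)
pose K := d%:R * (`|y| + `|x| + 1 + `|p|) + 1.
have K0 : 0 < K by rewrite ltr_wpDl// mulr_ge0// !addr_ge0.
pose r := Num.min 1 (e / 2 / K).
have r0 : 0 < r by rewrite lt_min ltr01 !divr_gt0.
have r1 : r <= 1 by rewrite ge_min lexx.
have rK : r * K <= e / 2 by rewrite -ler_pdivlMr// ge_min lexx orbT.
have [_ [[x' [/= Gx' Px' xx'] <-] pgx']] : (grad Phi @` [set x' | [/\ G x',
    `|Phi x - Phi x'| <= e / 2 & `|x - x'| <= r]] `&` ball p r) !=set0.
  apply: clp; last exact: nbhsx_ballx.
  suff : \forall x' \near x, `|Phi x - Phi x'| <= e / 2 /\ `|x - x'| <= r.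
    by apply: filterS => x' [Px' xx'] Gx'; exists x'.
  near=> x'; split; near: x'.
    have /cvgrPdist_le := differentiable_continuous dx; apply.
    by rewrite divr_gt0.
  by apply: (@cvgr_dist_le _ _ _ _ _ id x) => //; exact: cvg_id.
have [Ax' dx'] := GD _ Gx'.
have := convex_gradient_le cPhi (interior_subset Ax') Ay dx'.
move: pgx'; rewrite -ball_normE/= => pgx'.
have -> : dotrv p (y - x) = dotrv (grad Phi x') (y - x') +
    dotrv (p - grad Phi x') (y - x') + dotrv p (x' - x).
  by rewrite dotrvBl !dotrvBr; ring.
have yx' : `|y - x'| <= `|y| + `|x| + 1.
  rewrite (le_trans (ler_normB _ _))// -addrA lerD2l.
  by rewrite -[x'](subrKC x) (le_trans (ler_normD _ _))// lerD2l distrC (le_trans xx').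
have h1 : dotrv (p - grad Phi x') (y - x') <= d%:R * (r * (`|y| + `|x| + 1)).
  rewrite (le_trans (ler_norm _))// (le_trans (dotrv_le _ _))// ler_wpM2l//.
  by rewrite ler_pM// ltW.
have h2 : dotrv p (x' - x) <= d%:R * (r * `|p|).
  rewrite (le_trans (ler_norm _))// (le_trans (dotrv_le _ _))// ler_wpM2l//.
  by rewrite mulrC distrC ler_wpM2r.
have h3 : d%:R * (r * (`|y| + `|x| + 1)) + d%:R * (r * `|p|) <= e / 2.
  by apply: le_trans rK; rewrite /K; nra.
have := ler_norm (Phi x - Phi x'); lra.
Unshelve. all: by end_near. Qed.

End domain.
End convex_gradient.

Lemma lipschitz_bound_continuous (R : realType) (V : normedModType R) (F : V -> R)
    (L : R) : 0 <= L -> (forall u v, `|F u - F v| <= L * `|u - v|) -> continuous F.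
Proof.
move=> L0 FL y; apply/cvgrPdist_le => e e0.
have L1 : 0 < L + 1 by rewrite ltr_wpDl.
near=> v; apply: (le_trans (FL _ _)).
rewrite (@le_trans _ _ ((L + 1) * `|y - v|))// ?ler_wpM2r ?lerDl//.
rewrite mulrC -ler_pdivlMr//; near: v.
by apply: (@cvgr_dist_le _ _ _ _ _ id y); [exact: cvg_id|rewrite divr_gt0].
Unshelve. all: by end_near. Qed.

Section total_gradient.
Context {R : realType} {d : nat}.
Local Notation E := 'rV[R]_d.
Variables (A : set E) (Phi : E -> R).
Local Notation D := (grad_domain A Phi).

(** An everywhere defined measurable map that agrees with the gradient on its domain. *)
Definition total_grad : E -> E := grad Phi \_ D.

Lemma measurable_total_grad : measurable D -> measurable_fun D (grad Phi) ->
  measurable_fun setT total_grad.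
Proof. by move=> mD mg; apply/(measurable_restrictT _ mD). Qed.

Lemma total_gradE x : D x -> total_grad x = grad Phi x.
Proof. by move=> Dx; rewrite /total_grad patchE mem_set. Qed.

End total_gradient.

(** * Maps with a Lipschitz inverse *)

Section lipschitz_inverse.
Context {R : realType} {d : nat}.
Local Notation E := 'rV[R]_d.
Variables (D : set E) (h : E -> E) (L : R).
Hypothesis L_ge0 : 0 <= L.
Hypothesis hL : forall x y, D x -> D y -> `|x - y| <= L * `|h x - h y|.

(** McShane extension: each coordinate of the inverse, which is Lipschitz on the image of h,
    extends to the whole space as the infimum over x in D of x_i + L |h x - y|. *)
Lemma lipschitz_left_inverse : exists S : E -> E,
  measurable_fun setT S /\ forall x, D x -> S (h x) = x.
Proof.
have [->|/set0P[z0 Dz0]] := eqVneq D set0.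
  by exists (cst 0); split=> //; exact: measurable_cst.
pose V i (y : E) := [set x ord0 i + L * `|h x - y| | x in D].
have V0 i y : V i y !=set0 by exists (z0 ord0 i + L * `|h z0 - y|), z0.
have coordB (x y : E) i : x ord0 i - y ord0 i <= `|x - y|.
  by have := coord_le_norm (x - y) i; rewrite !mxE; apply: le_trans; exact: ler_norm.
have Vlb i y : has_lbound (V i y).
  exists (z0 ord0 i - L * `|h z0 - y|) => _ [x Dx <-].
  have := le_trans (coordB z0 x i) (hL Dz0 Dx).
  have : L * `|h z0 - h x| <= L * (`|h z0 - y| + `|h x - y|).
    by rewrite ler_wpM2l// (distrC (h x)) ler_distD.
  lra.
pose S (y : E) : E := \row_i inf (V i y).
exists S; split; last first.
  move=> x Dx; apply/rowP => i; rewrite mxE; apply/eqP; rewrite eq_le.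
  apply/andP; split.
    by apply: ge_inf => //; exists x => //; rewrite subrr normr0 mulr0 addr0.
  apply: lb_le_inf => // _ [y Dy <-].
  have := le_trans (coordB x y i) (hL Dx Dy); rewrite (distrC (h x)); lra.
apply: measurable_fun_rVP => i; apply: continuous_rV_measurable.
have lip u v : inf (V i u) - L * `|u - v| <= inf (V i v).
  apply: lb_le_inf => // _ [x Dx <-]; rewrite lerBlDr.
  apply: (@le_trans _ _ (x ord0 i + L * `|h x - u|)).
    by apply: ge_inf => //; exists x.
  rewrite -addrA lerD2l -mulrDr ler_wpM2l// (distrC u) ler_distD//.
apply: (lipschitz_bound_continuous L_ge0) => u v; rewrite !mxE ler_norml.
have := lip u v; have := lip v u; rewrite (distrC v) => h1 h2.
by apply/andP; split; lra.
Qed.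

(** The image is the set of y such that S y lies in D and h (S y) = y. *)
Lemma measurable_image (S : E -> E) : measurable D -> measurable_fun D h ->
  measurable_fun setT S -> (forall x, D x -> S (h x) = x) -> measurable (h @` D).
Proof.
move=> mD mh mS Sh.
have mSD : measurable (S @^-1` D) by rewrite -[X in measurable X]setTI; exact: mS.
have mhS : measurable_fun (S @^-1` D) (h \o S).
  apply: (measurable_comp mD) => //; first by move=> _ [y Dy <-].
  exact: measurable_funTS.
rewrite (_ : h @` D = S @^-1` D `&` \bigcap_(i in [set: 'I_d])
    (S @^-1` D `&` [set y | h (S y) ord0 i == y ord0 i])).
  apply: measurableI => //.
  apply: (@fin_bigcap_measurable _ _ 'I_d) => // i _.
  have mhSi : measurable_fun (S @^-1` D) (fun y => h (S y) ord0 i).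
    exact: measurableT_comp (measurable_rV_coord i) mhS.
  have := measurable_fun_eqr mhSi (measurable_funTS (measurable_rV_coord i)).
  by move=> /(_ mSD [set true] I).
apply/seteqP; split=> [_ [x Dx <-]|y [DSy hSy]].
  by split=> [|i _]; rewrite /= Sh// eqxx.
exists (S y) => //; apply/rowP => i; have [_ /eqP] := hSy i I.
by [].
Qed.

End lipschitz_inverse.


(** * Differentiating along the flow *)

Section clamp.
Context {R : realType}.
Variable T : R.
Hypothesis T_gt0 : 0 < T.

(** The flow is frozen outside [0, T], so that it is defined for all times and continuous in
    a neighbourhood of 0 and of T. *)
Definition clamp (t : R) : R := Num.max 0 (Num.min t T).

Lemma clamp_itv t : 0 <= clamp t <= T.
Proof. by rewrite /clamp le_max lexx ge_max (ltW T_gt0) ge_min lexx orbT. Qed.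

Lemma clamp_id t : 0 <= t <= T -> clamp t = t.
Proof. by move=> /andP[t0 tT]; rewrite /clamp min_l// max_r. Qed.

Lemma continuous_clamp : continuous clamp.
Proof.
apply: (@lipschitz_bound_continuous R R^o clamp 1) => // u v.
rewrite mul1r /clamp; have := ler_norm (u - v); have := ler_norm (v - u).
rewrite (distrC v u) ler_norml.
by case: (leP u T); case: (leP v T); case: (leP 0 u); case: (leP 0 v);
  case: (leP 0 T) => *; apply/andP; split; lra.
Qed.

End clamp.

Section flow_derivative.
Context {R : realType} {d : nat}.
Local Notation E := 'rV[R]_d.

(** The difference quotients in s are those of the directional derivative of phi along b. *)
Lemma is_derive_line (phi : E -> R) (a b : E) (s : R) :
  differentiable phi (a + s *: b) ->
  is_derive s (1 : R) (fun s => phi (a + s *: b)) (dotrv (grad phi (a + s *: b)) b).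
Proof.
move=> dphi; rewrite -derive_dotrv//.
have E1 : (fun h : R => h^-1 *: (((fun s => phi (a + s *: b)) \o shift s) (h *: (1 : R))
      - phi (a + s *: b))) =
    (fun h : R => h^-1 *: ((phi \o shift (a + s *: b)) (h *: b) - phi (a + s *: b))).
  apply/funext => h /=; congr (_ *: (phi _ - _)).
  by rewrite -[_ *: 1]/(_ * _) mulr1 scalerDl addrCA.
split; first by rewrite /derivable E1; exact: (@diff_derivable _ _ _ phi _ b dphi).
by rewrite /derive E1.
Qed.

(** With p and q the values of k1 at x and of k2 at grad Phi x, divided by T, this is the
    derivative of the density carried along a trajectory. *)
Lemma is_derive_ratio (a p q s : R) : 1 - s * q != 0 ->
  is_derive s (1 : R) (fun s => a * (1 - s * p) / (1 - s * q))
    (a * (q - p) / (1 - s * q) ^+ 2).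
Proof.
move=> q0.
have lin (r : R) : is_derive s (1 : R) (fun s => 1 - s * r) (- r).
  have -> : (fun s => 1 - s * r) = cst 1 - (r \*: (id : R -> R)).
    by apply/funext => u; rewrite !fctE /= mulrC.
  by apply: is_derive_eq; rewrite sub0r -[_ *: _]/(_ * _) mulr1.
have := is_deriveM (is_deriveZ a (lin p)) (@is_deriveV _ (fun s => 1 - s * q) s _ _ q0 (lin q)).
move/is_derive_eq; apply.
rewrite /= /GRing.scale /=; field.
exact: q0.
Qed.

End flow_derivative.

Section flow.
Context {R : realType} {d : nat}.
Local Notation E := 'rV[R]_d.
Local Notation leb := (@lebesgue_rV R d).
Variables (T M eta rho : R) (f k1 k2 Phi : E -> R) (A G : set E).
Local Notation D := (grad_domain A Phi).
Hypotheses (T_gt0 : 0 < T) (eta_gt0 : 0 < eta) (eta_le1 : eta <= 1).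
Hypotheses (mD : measurable D) (mgrad : measurable_fun D (grad Phi)).
Hypothesis cPhi : convex_function A Phi.
Hypotheses (mG : measurable G) (GD : G `<=` D) (Goo : (leb G < +oo)%E).
Let kappa x := k2 (grad Phi x).
Hypotheses (mf : measurable_fun setT f) (mk1 : measurable_fun D k1).
Hypothesis mkappa : measurable_fun D (fun x => k2 (grad Phi x)).
Hypothesis f_bnd : forall x, G x -> 0 <= f x <= M.
Hypothesis k1_le : forall x, G x -> k1 x <= 1 - eta.
Hypothesis kappa_le : forall x, G x -> k2 (grad Phi x) <= 1 - eta.
Hypothesis x_bnd : forall x, G x -> `|x| <= rho.
Hypothesis grad_bnd : forall x, G x -> `|grad Phi x| <= rho.
Hypothesis ik1 : leb.-integrable G (EFin \o k1).
Hypothesis ikappa : leb.-integrable G (fun x => (k2 (grad Phi x))%:E).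

(** For each x in G it solves m' = rho m with m = f at t = 0, where rho is the growth rate along
    the trajectory of x. *)
Definition flow_density t x :=
  f x * (1 - t / T * k1 x) / (1 - t / T * k2 (grad Phi x)).

Let flow_density' t x :=
  f x * (kappa x - k1 x) / T / (1 - t / T * kappa x) ^+ 2.

(** 1 - s k = (1 - s) + s (1 - k) >= (1 - s) + s eta >= eta for s = t / T in [0, 1]. *)
Let one_sub_ge t (k : R) : 0 <= t <= T -> k <= 1 - eta -> eta <= 1 - t / T * k.
Proof.
move=> /andP[t0 tT] ke; pose s := t / T.
have s0 : 0 <= s by rewrite divr_ge0// ltW.
have s1 : s <= 1 by rewrite ler_pdivrMr// mul1r.
rewrite -/s; have := ler_wpM2l s0 ke.
have : s * (1 - eta) <= 1 - eta by rewrite ler_piMl// subr_ge0.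
lra.
Qed.

Let flow_density_bounds t x : 0 <= t <= T -> G x ->
  0 <= flow_density t x <= M / eta * (1 + `|k1 x|).
Proof.
move=> tT Gx; have /andP[f0 fM] := f_bnd Gx.
have d1 := one_sub_ge tT (k1_le Gx); have d2 := one_sub_ge tT (kappa_le Gx).
have d20 : 0 < 1 - t / T * k2 (grad Phi x) by exact: lt_le_trans d2.
have s01 : 0 <= t / T <= 1.
  by case/andP: tT => t0 tT; rewrite divr_ge0 ?(ltW T_gt0)//= ler_pdivrMr// mul1r.
have up : 1 - t / T * k1 x <= 1 + `|k1 x|.
  rewrite lerD2l; case/andP: s01 => s0 s1.
  rewrite (le_trans (ler_norm _))// normrN normrM ger0_norm//.
  by rewrite ler_piMl.
apply/andP; split.
  by rewrite /flow_density divr_ge0 ?(ltW d20)// mulr_ge0// (le_trans (ltW eta_gt0)).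
rewrite /flow_density mulrAC ler_pM//.
- by rewrite divr_ge0// ltW.
- by rewrite (le_trans (ltW eta_gt0)).
- by rewrite ler_pM// ?invr_ge0 ?(ltW d20)// lef_pV2.
Qed.

Let flow_density'_bound t x : 0 <= t <= T -> G x ->
  `|flow_density' t x| <= M / T / eta ^+ 2 * (`|kappa x| + `|k1 x|).
Proof.
move=> tT Gx; have /andP[f0 fM] := f_bnd Gx.
have d2 := one_sub_ge tT (kappa_le Gx).
have d20 : 0 < 1 - t / T * kappa x by exact: lt_le_trans d2.
rewrite /flow_density' !normrM !normfV normrX (ger0_norm f0) (gtr0_norm T_gt0) (gtr0_norm d20).
have -> : f x * `|kappa x - k1 x| / T / (1 - t / T * kappa x) ^+ 2 =
  f x / T / (1 - t / T * kappa x) ^+ 2 * `|kappa x - k1 x| by ring.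
apply: ler_pM => //; last exact: ler_normB.
  by rewrite !divr_ge0 ?exprn_ge0 ?(ltW d20) ?(ltW T_gt0).
apply: ler_pM; rewrite ?divr_ge0 ?invr_ge0 ?exprn_ge0 ?(ltW d20) ?(ltW T_gt0)//.
  by rewrite ler_wpM2r// invr_ge0 ltW.
by rewrite lef_pV2 ?posrE ?exprn_gt0// lerXn2r ?nnegrE ?(ltW eta_gt0) ?(ltW d20).
Qed.

Lemma interpolationE t x :
  interpolation T Phi t x = x + t *: (T^-1 *: (grad Phi x - x)).
Proof.
rewrite /interpolation scalerA scalerBr mulrBl divff ?gt_eqF// scalerBl scale1r.
by rewrite -addrA [in RHS]addrC addrA addrAC [in RHS]addrC addrA addrAC.
Qed.

Lemma interpolation_norm t x : 0 <= t <= T -> G x -> `|interpolation T Phi t x| <= rho.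
Proof.
move=> /andP[t0 tT] Gx; rewrite /interpolation.
rewrite (le_trans (ler_normD _ _))// !normrZ.
rewrite !ger0_norm ?divr_ge0 ?invr_ge0 ?subr_ge0 ?(ltW T_gt0)//.
apply: (@le_trans _ _ ((T - t) / T * rho + t / T * rho)).
  by apply: lerD; apply: ler_wpM2l; rewrite ?divr_ge0 ?subr_ge0 ?(ltW T_gt0) ?grad_bnd ?x_bnd.
by rewrite -mulrDl -mulrDl subrK divff ?gt_eqF// mul1r.
Qed.

Definition transport_map t x := ((T - t) / T) *: x + (t / T) *: total_grad A Phi x.

Let transport_mapE t x : D x -> transport_map t x = interpolation T Phi t x.
Proof. by move=> Dx; rewrite /transport_map total_gradE. Qed.

Let measurable_transport_map t : measurable_fun setT (transport_map t).
Proof.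
apply: measurable_fun_rVP => i.
rewrite (_ : (fun x => _) = (fun x : E => (T - t) / T * x ord0 i +
    t / T * total_grad A Phi x ord0 i)); last by apply/funext => x; rewrite !mxE.
apply: measurable_funD; apply: measurable_funM => //.
  exact: measurable_rV_coord.
exact: measurableT_comp (measurable_rV_coord i) (measurable_total_grad mD mgrad).
Qed.

Let mGrad : measurable_fun G (grad Phi). Proof. exact: measurable_funS mgrad. Qed.
Let mGk1 : measurable_fun G k1. Proof. exact: measurable_funS mk1. Qed.
Let mGkappa : measurable_fun G (fun x => k2 (grad Phi x)).
Proof. exact: measurable_funS mkappa. Qed.
Let mGf : measurable_fun G f. Proof. exact: measurable_funTS. Qed.

Let measurable_interp (phi : E -> R) t : measurable_fun setT phi ->
  measurable_fun G (fun x => phi (interpolation T Phi t x)).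
Proof.
move=> mphi; apply: (eq_measurable_fun (phi \o transport_map t)).
  by move=> x /set_mem /GD Dx; rewrite /= transport_mapE.
by apply: measurable_funTS; apply: measurableT_comp.
Qed.

Let measurable_flow_density t : measurable_fun G (flow_density t).
Proof.
apply: measurable_funM.
  apply: measurable_funM => //; apply: measurable_funB => //.
  exact: measurable_funM.
apply: (measurableT_comp (@measurable_invr R)); apply: measurable_funB => //.
exact: measurable_funM.
Qed.

Let integrable_flow_bound a : leb.-integrable G (fun x => (a * (1 + `|k1 x|))%:E).
Proof.
apply: integrable_scaler => //; apply: integrable_addr => //.
  by apply: L2_integrable => //; exact: L2_cst.
exact: (integrable_abse ik1).
Qed.

Let integrable_flow_bound' a :
  leb.-integrable G (fun x => (a * (`|kappa x| + `|k1 x|))%:E).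
Proof.
apply: integrable_scaler => //; apply: integrable_addr => //.
  exact: (integrable_abse ikappa).
exact: (integrable_abse ik1).
Qed.

Let integrable_flow_density t : 0 <= t <= T ->
  leb.-integrable G (fun x => (flow_density t x)%:E).
Proof.
move=> tT; apply: (ae_le_integrable mG _ (integrable_flow_bound (M / eta))) => //.
by apply: aeW => x Gx; have /andP[m0 mM] := flow_density_bounds tT Gx; rewrite ger0_norm.
Qed.

(** Mass is only put on G, where the bounds on k1, k2 and f hold pointwise. *)
Definition flow_mass t : E -> R := flow_density t \_ G.
Local Notation dens := flow_mass.

Let measurable_dens t : measurable_fun setT (dens t).
Proof. exact/(measurable_restrictT _ mG). Qed.

Let dens_ge0 t : 0 <= t <= T -> forall x, 0 <= dens t x.
Proof.
move=> tT x; rewrite /flow_mass patchE; case: ifPn => // /set_mem Gx.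
by have /andP[] := flow_density_bounds tT Gx.
Qed.

Lemma exists_flow_measure t : 0 <= t <= T ->
  exists nu : {finite_measure set E -> \bar R}, forall S, measurable S ->
    nu S = (\int[leb]_(x in transport_map t @^-1` S) (dens t x)%:E)%E.
Proof.
move=> tT; apply: exists_transported_measure => //; first exact: dens_ge0.
have /(integrable_mkcond _ mG)/integrableP[_] := integrable_flow_density tT.
apply: le_lt_trans; apply: ge0_le_integral => //.
- by move=> x _; rewrite lee_fin dens_ge0.
- by apply/measurable_EFinP; exact: measurable_dens.
- apply: measurableT_comp => //; apply/(measurable_restrictT _ mG).
  by apply/measurable_EFinP.
- move=> x _; rewrite /flow_mass !patchE; case: ifP => _; last by rewrite abse0.
  by rewrite lee_fin ler_norm.
Qed.

Let integral_off_G (P : set E) (V W : E -> R) : measurable P -> G `<=` P ->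
  (forall x, G x -> V x = W x) -> (forall x, ~ G x -> V x = 0) ->
  leb.-integrable G (fun x => (W x)%:E) ->
  leb.-integrable P (fun x => (V x)%:E) /\
  \int[leb]_(x in P) V x = \int[leb]_(x in G) W x.
Proof.
move=> mP GP VW V0 iW.
have E1 : (fun x => (V x)%:E) \_ P = (fun x => (W x)%:E) \_ G.
  apply/funext => x; rewrite !patchE; have [Gx|nGx] := pselect (G x).
    by rewrite (mem_set Gx) (mem_set (GP _ Gx)) VW.
  by rewrite (memNset nGx); case: ifP => // _; rewrite V0.
split; first by apply/(integrable_mkcond _ mP); rewrite E1; apply/(integrable_mkcond _ mG).
by rewrite /Rintegral integral_mkcond E1 -integral_mkcond.
Qed.

(** All the trajectories stay in a fixed closed ball, on which phi and its partial
    derivatives are bounded. *)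
Let continuous_bounded (phi : E -> R) : continuous phi ->
  exists2 B, 0 <= B & forall z, `|z| <= rho -> `|phi z| <= B.
Proof.
move=> cphi.
have cball : compact [set z : E | `|z| <= rho].
  apply: bounded_closed_compact.
    by exists rho; split; [exact: num_real|move=> N rN z /= /le_trans; apply; exact: ltW].
  rewrite (_ : [set z | _] = (@Num.norm R E) @^-1` [set r | r <= rho])//.
  by apply: closed_comp; [move=> z _; exact: norm_continuous|exact: closed_le].
have := continuous_compact (continuous_subspaceT cphi) cball.
move=> /compact_bounded[B [_ phiB]]; exists (`|B| + 1) => // z zr.
apply: (phiB (`|B| + 1)); first by rewrite (le_lt_trans (ler_norm B))// ltrDl.
by exists z.
Qed.

Local Notation image := (interpolation_image T A Phi).
Local Notation inv := (interpolation_inv T A Phi).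

Lemma interpolation_invK t x : 0 < t < T -> D x ->
  inv t (interpolation T Phi t x) = x.
Proof.
by move=> tT Dx; apply: pinvKV; [exact: interpolation_inj|exact: mem_set].
Qed.

(** The inverse on the image agrees there with a globally defined measurable map, which also
    gives measurability of the image. *)
Let measurable_interpolation_image_inv t : 0 < t < T ->
  measurable (image t) /\ measurable_fun (image t) (inv t).
Proof.
move=> tT; have /andP[t0 t1] := tT; pose a := (T - t) / T.
have a0 : 0 < a by rewrite divr_gt0// subr_gt0.
have L0 : 0 <= d%:R / a by rewrite divr_ge0// ltW.
have hL x y : D x -> D y -> `|x - y| <=
    d%:R / a * `|interpolation T Phi t x - interpolation T Phi t y|.
  move=> Dx Dy; rewrite mulrAC ler_pdivlMr// mulrC.
  exact: interpolation_expansive.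
have [S [mS Sh]] := lipschitz_left_inverse L0 hL.
have mh : measurable_fun D (interpolation T Phi t).
  apply: (eq_measurable_fun (transport_map t)).
    by move=> x /set_mem Dx; rewrite transport_mapE.
  exact: measurable_funTS.
split; first exact: measurable_image mD mh mS Sh.
apply: (eq_measurable_fun S); last exact: measurable_funTS.
by move=> _ /set_mem[x Dx <-]; rewrite Sh// interpolation_invK.
Qed.

Variable mu : R -> {finite_measure set E -> \bar R}.
Hypothesis muE : forall t S, measurable S ->
  mu t S = (\int[leb]_(x in transport_map (clamp T t) @^-1` S)
              (dens (clamp T t) x)%:E)%E.

Let muE_in t S : 0 < t < T -> measurable S ->
  mu t S = (\int[leb]_(x in transport_map t @^-1` S) (dens t x)%:E)%E.
Proof. by move=> /andP[t0 tT] mS; rewrite muE// clamp_id// !ltW. Qed.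

Let G_pre t : G `<=` transport_map t @^-1` image t.
Proof. by move=> x Gx; exists x; rewrite ?transport_mapE//; exact: GD. Qed.

Let flow_carried t : 0 < t < T -> measurable (image t) /\ mu t (~` image t) = 0%E.
Proof.
move=> tT; have [mI _] := measurable_interpolation_image_inv tT; split=> //.
rewrite muE_in//; last exact: measurableC.
apply: integral0_eq => x /= nI; rewrite /flow_mass patchE memNset// => Gx.
exact/nI/G_pre.
Qed.

Section test.
Variable phi : E -> R.
Hypothesis dphi : forall z, differentiable phi z.
Hypothesis cdphi : forall i, continuous (fun z => 'D_(delta_mx ord0 i) phi z).

Let cphi : continuous phi.
Proof. by move=> z; exact: differentiable_continuous. Qed.

Let mphi : measurable_fun setT phi. Proof. exact: continuous_rV_measurable. Qed.

Let vel x : E := T^-1 *: (grad Phi x - x).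

Let flow_integrand t x := phi (interpolation T Phi t x) * flow_density t x.
Let advection t x := dotrv (grad phi (interpolation T Phi t x)) (vel x) * flow_density t x.
Let reaction t x := phi (interpolation T Phi t x) * flow_density' t x.

Let is_derive_flow_integrand t x : 0 <= t <= T -> G x ->
  is_derive t (1 : R) (flow_integrand ^~ x) (advection t x + reaction t x).
Proof.
move=> tT Gx; have d2 := one_sub_ge tT (kappa_le Gx).
have d20 : 1 - t * (kappa x / T) != 0.
  by rewrite mulrA mulrAC gt_eqF// (lt_le_trans eta_gt0).
have := is_deriveM (is_derive_line (dphi (x + t *: vel x)))
  (is_derive_ratio (f x) (k1 x / T) d20).
set F := (_ * _)%R; have -> : F = flow_integrand ^~ x.
  apply/funext => s; rewrite /F /flow_integrand /flow_density interpolationE.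
  have r (q : R) : s * (q / T) = s / T * q by rewrite mulrA mulrAC.
  rewrite -[LHS]/(phi (x + s *: vel x) *
    (f x * (1 - s * (k1 x / T)) / (1 - s * (kappa x / T)))).
  by rewrite !r.
move/is_derive_eq; apply.
rewrite /advection /reaction /flow_density /flow_density' !interpolationE -/(vel x).
rewrite /GRing.scale /= -/(kappa x).
have -> : t * (k1 x / T) = t / T * k1 x by ring.
have -> : t * (kappa x / T) = t / T * kappa x by ring.
by ring.
Qed.

Let vel_norm x : G x -> `|vel x| <= T^-1 * (rho + rho).
Proof.
move=> Gx; rewrite /vel normrZ gtr0_norm ?invr_gt0// ler_pM2l ?invr_gt0//.
by rewrite (le_trans (ler_normB _ _))// lerD ?grad_bnd ?x_bnd.
Qed.

Let grad_bounded : exists2 B, 0 <= B &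
  forall z b, `|z| <= rho -> `|dotrv (grad phi z) b| <= B * `|b|.
Proof.
have /choice[B BP] : forall i : 'I_d, exists B, 0 <= B /\
    forall z, `|z| <= rho -> `|'D_(delta_mx ord0 i) phi z| <= B.
  by move=> i; have [B B0 phiB] := continuous_bounded (@cdphi i); exists B.
exists (\sum_i B i); first by apply: sumr_ge0 => i _; case: (BP i).
move=> z b zr; rewrite (le_trans (ler_norm_sum _ _ _))// mulr_suml.
apply: ler_sum => i _; rewrite mxE normrM ler_pM// ?coord_le_norm//.
by case: (BP i) => _; exact.
Qed.

(** The bounds are uniform in t, with the integrable functions of x on the right as dominating
    functions for passing to the limit under the integral. *)
Let flow_bounds : exists a1 a2, [/\ 0 <= a1, 0 <= a2 & forall t x, 0 <= t <= T -> G x ->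
  [/\ `|flow_integrand t x| <= a1 * (1 + `|k1 x|),
      `|advection t x| <= a1 * (1 + `|k1 x|) &
      `|reaction t x| <= a2 * (`|kappa x| + `|k1 x|)]].
Proof.
have [B B0 phiB] := continuous_bounded cphi; have [C C0 gradC] := grad_bounded.
pose M' := `|M|; pose r := T^-1 * (`|rho| + `|rho|).
have M'0 : 0 <= M' by exact: normr_ge0.
have r0 : 0 <= r by rewrite mulr_ge0 ?addr_ge0// invr_ge0 ltW.
exists ((B + C * r) * (M' / eta)), (B * (M' / T / eta ^+ 2)); split.
- by rewrite mulr_ge0 ?addr_ge0 ?mulr_ge0 ?divr_ge0// ?invr_ge0 ltW.
- by rewrite !mulr_ge0 ?invr_ge0 ?exprn_ge0 ?(ltW T_gt0) ?(ltW eta_gt0).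
move=> t x tT Gx; have zr := interpolation_norm tT Gx.
have /andP[m0 mM] := flow_density_bounds tT Gx; have m'M := flow_density'_bound tT Gx.
have k10 : 0 <= 1 + `|k1 x| by rewrite addr_ge0.
have mM' : `|flow_density t x| <= M' / eta * (1 + `|k1 x|).
  rewrite ger0_norm// (le_trans mM)// ler_wpM2r// ler_wpM2r ?ler_norm//.
  by rewrite invr_ge0 ltW.
have m'M' : `|flow_density' t x| <= M' / T / eta ^+ 2 * (`|kappa x| + `|k1 x|).
  rewrite (le_trans m'M)// ler_wpM2r ?addr_ge0// !ler_wpM2r ?ler_norm//.
    by rewrite invr_ge0 exprn_ge0// ltW.
  by rewrite invr_ge0 ltW.
have Me0 : 0 <= M' / eta * (1 + `|k1 x|) by rewrite !mulr_ge0 ?invr_ge0 ?(ltW eta_gt0).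
split.
- rewrite normrM (le_trans (ler_pM _ _ (phiB _ zr) mM'))//.
  by rewrite -[leRHS]mulrA ler_wpM2r// lerDl mulr_ge0.
- rewrite normrM (le_trans (ler_pM _ _ (gradC _ (vel x) zr) mM'))//.
  rewrite -[leRHS]mulrA ler_wpM2r//; apply: (@le_trans _ _ (C * r)); last by rewrite lerDr.
  rewrite ler_wpM2l// (le_trans (vel_norm Gx))// ler_wpM2l ?invr_ge0 ?(ltW T_gt0)//.
  by rewrite lerD// ler_norm.
- by rewrite normrM (le_trans (ler_pM _ _ (phiB _ zr) m'M'))// mulrA.
Qed.

Let mgradphi i : measurable_fun setT (fun z => 'D_(delta_mx ord0 i) phi z).
Proof. by apply: continuous_rV_measurable; exact: cdphi. Qed.

Let mreaction t : measurable_fun G (reaction t).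
Proof.
apply: measurable_funM; first exact: measurable_interp.
apply: measurable_funM.
  apply: measurable_funM => //; apply: measurable_funM => //.
  exact: measurable_funB.
apply: (measurableT_comp (@measurable_invr R)); apply: measurable_funX.
by apply: measurable_funB => //; exact: measurable_funM.
Qed.

Let madvection t : measurable_fun G (advection t).
Proof.
apply: measurable_funM; last exact: measurable_flow_density.
apply: measurable_sum => i; apply: measurable_funM.
  apply: (eq_measurable_fun
    (fun x => 'D_(delta_mx ord0 i) phi (interpolation T Phi t x))).
    by move=> x _; rewrite mxE.
  exact: (measurable_interp t (mgradphi i)).
apply: (eq_measurable_fun (fun x => T^-1 * (grad Phi x ord0 i - x ord0 i))).
  by move=> x _; rewrite !mxE.
apply: measurable_funM => //; apply: measurable_funB.
  exact: measurableT_comp (measurable_rV_coord i) mGrad.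
by apply: measurable_funTS; exact: measurable_rV_coord.
Qed.

Let integrable_flow t : 0 <= t <= T ->
  [/\ leb.-integrable G (fun x => (flow_integrand t x)%:E),
      leb.-integrable G (fun x => (advection t x)%:E) &
      leb.-integrable G (fun x => (reaction t x)%:E)].
Proof.
move=> tT; have [a1 [a2 [_ _ aP]]] := flow_bounds; split.
- apply: (ae_le_integrable mG _ (integrable_flow_bound a1)).
    by apply: measurable_funM => //; exact: measurable_interp.
  by apply: aeW => x Gx; have [] := aP t x tT Gx.
- apply: (ae_le_integrable mG _ (integrable_flow_bound a1)) => //.
  by apply: aeW => x Gx; have [] := aP t x tT Gx.
- apply: (ae_le_integrable mG _ (integrable_flow_bound' a2)) => //.
  by apply: aeW => x Gx; have [] := aP t x tT Gx.
Qed.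

Let flow_integral t := \int[leb]_(x in G) flow_integrand t x.

Let clamp01 t : 0 <= clamp T t <= T. Proof. exact: clamp_itv. Qed.

Lemma continuous_flow_integral :
  {within `[0, T], continuous (fun t => flow_integral (clamp T t))}.
Proof.
apply: continuous_in_subspaceT => t /set_mem; rewrite /= in_itv/= => /andP[t0 tT].
have [a1 [a2 [a10 a20 aP]]] := flow_bounds.
apply: (@continuity_under_integral _ _ _ leb (fun t => flow_integrand (clamp T t)) G mG
  (-1) (T + 1) _ _ (fun x => a1 * (1 + `|k1 x|))).
- by move=> s _; have [] := integrable_flow (clamp01 s).
- apply: aeW => x Gx s _.
  have [dF _] := is_derive_flow_integrand (clamp01 s) Gx.
  have /derivable1_diffP/differentiable_continuous cF := dF.
  apply: (@continuous_comp _ _ _ (clamp T) (flow_integrand ^~ x) s) => //.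
  exact: continuous_clamp.
- exact: integrable_flow_bound.
- by move=> s _; apply: aeW => x Gx; have [] := aP _ x (clamp01 s) Gx.
- by rewrite inE/= in_itv/=; apply/andP; split; lra.
Qed.

Lemma is_derive_flow_integral t : 0 < t < T ->
  is_derive t (1 : R) (fun t => flow_integral (clamp T t))
    (\int[leb]_(x in G) advection t x + \int[leb]_(x in G) reaction t x).
Proof.
move=> tT; have itv s : `]0, T[%classic s -> 0 <= s <= T.
  by rewrite /= in_itv/= => /andP[s0 sT]; rewrite !ltW.
have It : `]0, T[%classic t by rewrite /= in_itv.
have [a1 [a2 [a10 a20 aP]]] := flow_bounds.
have dF s x : `]0, T[%classic s -> G x ->
    is_derive s (1 : R) (flow_integrand ^~ x) (advection s x + reaction s x).
  by move=> /itv; exact: is_derive_flow_integrand.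
pose dom x := a1 * (1 + `|k1 x|) + a2 * (`|kappa x| + `|k1 x|).
have dom0 x : 0 <= dom x by rewrite addr_ge0 ?mulr_ge0 ?addr_ge0.
have idom : leb.-integrable G (EFin \o dom).
  by apply: integrable_addr => //; rewrite /dom.
have intF s : `]0, T[%classic s -> leb.-integrable G (EFin \o flow_integrand s).
  by move=> /itv/integrable_flow[].
have derF s x : `]0, T[%classic s -> G x -> derivable (flow_integrand ^~ x) s 1.
  by move=> Is Gx; case: (dF s x Is Gx).
have bF s x : `]0, T[%classic s -> G x -> `|partial1of2 flow_integrand s x| <= dom x.
  move=> Is Gx; rewrite partial1of2E; have [_ ->] := dF s x Is Gx.
  rewrite (le_trans (ler_normD _ _))// lerD//; by have [] := aP s x (itv s Is) Gx.
apply: (@near_eq_is_derive _ _ _ flow_integral).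
  near=> s; rewrite clamp_id// itv//= in_itv/=; apply/andP; split; near: s.
    by apply: lt_nbhsr; case/andP: tT.
  by apply: lt_nbhsl; case/andP: tT.
have der := derivable_under_integral mG It intF derF dom0 idom bF.
have val := differentiation_under_integral mG It intF derF dom0 idom bF.
split => //; rewrite -derive1E val.
have [_ ia ir] := integrable_flow (itv t It).
rewrite -RintegralD//; apply: eq_Rintegral => x /set_mem Gx.
by rewrite partial1of2E; case: (dF t x It Gx).
Unshelve. all: by end_near. Qed.

Let integral_test t : \int[mu t]_x phi x = flow_integral (clamp T t).
Proof.
rewrite (Rintegral_transported (measurable_dens _) (dens_ge0 (clamp01 t))
  (measurable_transport_map _) (muE t))//.
have [iF _ _] := integrable_flow (clamp01 t).
have VG x : G x -> phi (transport_map (clamp T t) x) * dens (clamp T t) x =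
    flow_integrand (clamp T t) x.
  by move=> Gx; rewrite transport_mapE ?/flow_mass ?patchE ?mem_set//; exact: GD.
have V0 x : ~ G x -> phi (transport_map (clamp T t) x) * dens (clamp T t) x = 0.
  by move=> nGx; rewrite /flow_mass patchE memNset// mulr0.
by rewrite preimage_setT; have [] := integral_off_G measurableT (fun x _ => I) VG V0 iF.
Qed.

Let mimage_grad t : 0 < t < T ->
  measurable_fun (image t) (fun y => grad Phi (inv t y)).
Proof.
move=> tT; have [mI minv] := measurable_interpolation_image_inv tT.
exact: (@measurable_comp _ _ _ _ _ _ D).
Qed.

Let mimage_comp t (u : E -> R) : 0 < t < T -> measurable_fun D u ->
  measurable_fun (image t) (fun y => u (inv t y)).
Proof.
move=> tT mu_; have [mI minv] := measurable_interpolation_image_inv tT.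
exact: (@measurable_comp _ _ _ _ _ _ D).
Qed.

Let mpre t S : measurable S -> measurable (transport_map t @^-1` S).
Proof.
by move=> mS; rewrite -[X in measurable X]setTI; exact: measurable_transport_map.
Qed.

(** The integral over the image is pulled back to G, where the inverse of the interpolation
    cancels. *)
Lemma advection_integral t : 0 < t < T ->
  (mu t).-integrable (image t)
    (fun x => (dotrv (grad phi x) (velocity T A Phi t x))%:E) /\
  \int[mu t]_(x in image t) dotrv (grad phi x) (velocity T A Phi t x) =
  \int[leb]_(x in G) advection t x.
Proof.
move=> tT; have /andP[t0 t1] := tT; have tT' : 0 <= t <= T by rewrite !ltW.
have [mI minv] := measurable_interpolation_image_inv tT.
have mV : measurable_fun (image t)
    (fun x => dotrv (grad phi x) (velocity T A Phi t x)).
  apply: measurable_sum => i; apply: measurable_funM.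
    apply: (eq_measurable_fun (fun z => 'D_(delta_mx ord0 i) phi z)).
      by move=> x _; rewrite mxE.
    exact: measurable_funTS.
  apply: (eq_measurable_fun (fun y =>
      T^-1 * (grad Phi (inv t y) ord0 i - inv t y ord0 i))).
    by move=> x _; rewrite !mxE.
  apply: measurable_funM => //; apply: measurable_funB.
    exact: measurableT_comp (measurable_rV_coord i) (mimage_grad tT).
  exact: measurableT_comp (measurable_rV_coord i) minv.
have [_ ia _] := integrable_flow tT'.
have VG x : G x ->
    dotrv (grad phi (transport_map t x)) (velocity T A Phi t (transport_map t x)) *
      dens t x = advection t x.
  move=> Gx; have Dx := GD Gx.
  rewrite transport_mapE// /velocity interpolation_invK//.
  by rewrite /flow_mass patchE mem_set.
have V0 x : ~ G x ->
    dotrv (grad phi (transport_map t x)) (velocity T A Phi t (transport_map t x)) *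
      dens t x = 0.
  by move=> nGx; rewrite /flow_mass patchE memNset// mulr0.
have [iV VE] := integral_off_G (mpre t mI) (@G_pre t) VG V0 ia.
split.
  apply: (integrable_transported (measurable_dens t) (dens_ge0 tT') (measurable_transport_map t) 
    (fun S mS => muE_in tT mS)) => //.
rewrite (Rintegral_transported (measurable_dens t) (dens_ge0 tT')
  (measurable_transport_map t) (fun S mS => muE_in tT mS))//.
Qed.

(** After pulling back to G this is the identity m rho = m' for the density m. *)
Lemma reaction_integral t : 0 < t < T ->
  (mu t).-integrable (image t)
    (fun x => (phi x * growth T A Phi k1 k2 t x)%:E) /\
  \int[mu t]_(x in image t) (phi x * growth T A Phi k1 k2 t x) =
  \int[leb]_(x in G) reaction t x.
Proof.
move=> tT; have /andP[t0 t1] := tT; have tT' : 0 <= t <= T by rewrite !ltW.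
have [mI minv] := measurable_interpolation_image_inv tT.
have mV : measurable_fun (image t) (fun x => phi x * growth T A Phi k1 k2 t x).
  apply: measurable_funM; first exact: measurable_funTS.
  have mratio (u : E -> R) : measurable_fun D u ->
      measurable_fun D (fun x => u x / (1 - t / T * u x)).
    move=> mu_; apply: measurable_funM => //.
    apply: (measurableT_comp (@measurable_invr R)); apply: measurable_funB => //.
    exact: measurable_funM.
  apply: (mimage_comp (u := fun x => T^-1 * (- (k1 x / (1 - t / T * k1 x)) +
    k2 (grad Phi x) / (1 - t / T * k2 (grad Phi x)))) tT).
  apply: measurable_funM => //; apply: measurable_funD; last exact: (mratio _ mkappa).
  by apply: measurable_funN; exact: mratio.
have [_ _ ir] := integrable_flow tT'.
have VG x : G x -> phi (transport_map t x) *
    growth T A Phi k1 k2 t (transport_map t x) * dens t x = reaction t x.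
  move=> Gx; have Dx := GD Gx.
  rewrite transport_mapE// /growth interpolation_invK// /flow_mass patchE mem_set//.
  have d1 := lt_le_trans eta_gt0 (one_sub_ge tT' (k1_le Gx)).
  have d2 := lt_le_trans eta_gt0 (one_sub_ge tT' (kappa_le Gx)).
  rewrite /reaction /flow_density /flow_density' /kappa.
  move: d1 d2; move: (phi _) (k1 x) (k2 _) (f x) => p a b q d1 d2.
  have nz r : 0 < 1 - t / T * r -> T - t * r != 0.
    move=> r0; rewrite (_ : _ - _ = T * (1 - t / T * r)).
      by rewrite mulf_neq0 ?gt_eqF.
    by field; rewrite gt_eqF.
  by field; rewrite !nz// gt_eqF.
have V0 x : ~ G x -> phi (transport_map t x) *
    growth T A Phi k1 k2 t (transport_map t x) * dens t x = 0.
  by move=> nGx; rewrite /flow_mass patchE memNset// mulr0.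
have [iV VE] := integral_off_G (mpre t mI) (@G_pre t) VG V0 ir.
split.
  apply: (integrable_transported (measurable_dens t) (dens_ge0 tT')
    (measurable_transport_map t) (fun S mS => muE_in tT mS)) => //.
rewrite (Rintegral_transported (measurable_dens t) (dens_ge0 tT')
  (measurable_transport_map t) (fun S mS => muE_in tT mS))//.
Qed.

Lemma flow_tested :
  {within `[0, T], continuous (fun t => \int[mu t]_x phi x)} /\
  forall t, 0 < t < T ->
    [/\ (mu t).-integrable (image t)
          (fun x => (dotrv (grad phi x) (velocity T A Phi t x))%:E),
        (mu t).-integrable (image t)
          (fun x => (phi x * growth T A Phi k1 k2 t x)%:E) &
        is_derive t (1 : R) (fun t => \int[mu t]_x phi x)
          (\int[mu t]_(x in image t) dotrv (grad phi x) (velocity T A Phi t x) +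
           \int[mu t]_(x in image t) (phi x * growth T A Phi k1 k2 t x))].
Proof.
have -> : (fun t => \int[mu t]_x phi x) = (fun t => flow_integral (clamp T t)).
  by apply/funext => t; exact: integral_test.
split; first exact: continuous_flow_integral.
move=> t tT; have [ia ->] := advection_integral tT.
have [ir ->] := reaction_integral tT.
by split=> //; exact: is_derive_flow_integral.
Qed.

End test.

Lemma test_function_C1 (phi : E -> R) : test_function phi ->
  (forall z, differentiable phi z) /\
  forall i, continuous (fun z => 'D_(delta_mx ord0 i) phi z).
Proof. by move=> [/(_ 1%N)[dphi cphi] _]; split. Qed.

Theorem flow_solves_continuity_equation :
  continuity_equation T (interpolation_image T A Phi) (velocity T A Phi)
    (growth T A Phi k1 k2) mu.
Proof.
split; first by move=> t tT; exact: flow_carried.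
by move=> phi /test_function_C1[dphi cdphi]; exact: flow_tested.
Qed.


End flow.


(** * The set of full measure and the endpoints of the flow *)

Section good_set.
Context {R : realType} {d : nat}.
Local Notation E := 'rV[R]_d.
Local Notation leb := (@lebesgue_rV R d).
Variables (c M eta : R) (f g k1 k2 Phi kx ky : E -> R).
Local Notation Of := (esupp f).
Local Notation Og := (esupp g).
Local Notation D := (grad_domain Of Phi).
Hypotheses (c_gt0 : 0 < c) (eta_gt0 : 0 < eta) (eta_le1 : eta <= 1).
Hypotheses (mf : measurable_fun setT f) (mg : measurable_fun setT g).
Hypotheses (cOf : compact Of) (cOg : compact Og).
Hypothesis f_ge : {ae leb, forall x, Of x -> c <= f x}.
Hypothesis g_ge : {ae leb, forall x, Og x -> c <= g x}.
Hypothesis f_le : {ae leb, forall x, Of x -> `|f x| <= M}.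
Hypothesis g_le : {ae leb, forall x, Og x -> `|g x| <= M}.
Hypotheses (k1_L2 : L2 leb Of k1) (k2_L2 : L2 leb Og k2).
Hypothesis k1_le : {ae leb, forall x, Of x -> k1 x <= 1 - eta}.
Hypothesis k2_le : {ae leb, forall x, Og x -> k2 x <= 1 - eta}.
Hypothesis kxE : {ae leb, forall x, Of x -> kx x = f x * (1 - k1 x)}.
Hypothesis kyE : {ae leb, forall y, Og y -> ky y = g y * (1 - k2 y)}.
Hypotheses (mkx : measurable_fun Of kx) (mky : measurable_fun Og ky).
Hypothesis Phi_sol : brenier_mccann Of Og kx ky Phi.

Let mOf : measurable Of. Proof. exact: compact_rV_measurable. Qed.
Let mOg : measurable Og. Proof. exact: compact_rV_measurable. Qed.
Let Ofoo : (leb Of < +oo)%E. Proof. exact: compact_rV_lty. Qed.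
Let Ogoo : (leb Og < +oo)%E. Proof. exact: compact_rV_lty. Qed.
Let mD : measurable D. Proof. by case: Phi_sol. Qed.
Let mgrad : measurable_fun D (grad Phi). Proof. by case: Phi_sol. Qed.
Let DOf : D `<=` Of. Proof. by move=> x [Ax _]; exact: interior_subset. Qed.

Let mk1 : measurable_fun Of k1. Proof. by have /(L2P _ mOf)[] := k1_L2. Qed.
Let mk2 : measurable_fun Og k2. Proof. by have /(L2P _ mOg)[] := k2_L2. Qed.

Definition good_target : set E :=
  [set y | [/\ Og y, c <= g y, `|g y| <= M & k2 y <= 1 - eta]].

Definition good_source : set E :=
  [set x | [/\ D x, c <= f x, `|f x| <= M, k1 x <= 1 - eta &
               good_target (grad Phi x)]].

Let measurable_good (A : set E) (u v : E -> R) : measurable A ->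
  measurable_fun setT u -> measurable_fun A v ->
  measurable [set x | [/\ A x, c <= u x, `|u x| <= M & v x <= 1 - eta]].
Proof.
move=> mA mu mv; have mu' : measurable_fun A u by exact: measurable_funTS.
have hc (t : R) : measurable_fun A (cst t : E -> R) by exact: measurable_cst.
have mle (p q : E -> R) : measurable_fun A p -> measurable_fun A q ->
    measurable (A `&` [set x | p x <= q x]).
  by move=> mp mq; have := measurable_fun_ler mp mq; move=> /(_ mA [set true] I).
have h1 := mle _ _ (hc c) mu'.
have h2 := mle _ _ (measurableT_comp (@normr_measurable R setT) mu') (hc M).
have h3 := mle _ _ mv (hc (1 - eta)).
have := measurableI _ _ h1 (measurableI _ _ h2 h3); congr measurable.
apply/seteqP; split=> x /=; first by move=> [[? ?] [[_ ?] [_ ?]]].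
by move=> [].
Qed.

Lemma measurable_good_target : measurable good_target.
Proof. exact: measurable_good. Qed.

Lemma measurable_good_source : measurable good_source.
Proof.
have mDk1 : measurable_fun D k1 by exact: measurable_funS mk1.
have := measurableI _ _ (measurable_good mD mf mDk1)
  (mgrad mD measurable_good_target).
congr measurable; apply/seteqP; split=> x /=; first by move=> [[? ? ? ?] [_ ?]].
by move=> [].
Qed.

Let mH := measurable_good_target.
Let mG := measurable_good_source.

Lemma good_target_full : leb (Og `\` good_target) = 0%E.
Proof.
have mHC := measurableD mOg mH; apply/(negligibleP leb mHC).
have := negligibleU g_ge (negligibleU g_le k2_le); apply: negligibleS.
move=> y [Oy nHy] /=; have [?|?] := pselect (c <= g y); last by left=> /(_ Oy).
have [?|?] := pselect (`|g y| <= M); last by right; left=> /(_ Oy).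
by right; right=> /(_ Oy) ?; exact: nHy.
Qed.

(** Apart from sets where a hypothesis fails, the complement consists of the set N of the
    points that grad Phi maps outside [good_target]. The push-forward identity gives it mass 0 for
    kx, and kx >= c eta > 0 on it. *)
Lemma good_source_full : leb (Of `\` good_source) = 0%E.
Proof.
have mGC := measurableD mOf mG; apply/(negligibleP leb mGC).
have [_ nD _ _ push] := Phi_sol.
pose N := D `&` grad Phi @^-1` (~` good_target).
have mN : measurable N by apply: mgrad => //; exact: measurableC.
have N0 : leb.-negligible N.
  apply/(negligibleP leb mN); apply/eqP; rewrite eq_le measure_ge0 andbT.
  have NOf : N `<=` Of by move=> x [/DOf].
  have kxN : (\int[leb]_(x in N) (kx x)%:E = 0)%E.
    rewrite push; last exact: measurableC.
    rewrite -setDE; apply: null_set_integral; [exact: measurableD| |].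
      by apply/measurable_EFinP; apply: measurable_funS mky => //; exact: subIsetl.
    exact: good_target_full.
  have ceta : 0 < c * eta by rewrite mulr_gt0.
  have Noo : (leb N < +oo)%E.
    by apply: le_lt_trans Ofoo; apply: le_measure; rewrite ?inE.
  have : (\int[leb]_(x in N) (cst (c * eta) x)%:E <= \int[leb]_(x in N) (kx x)%:E)%E.
    apply: ae_le_integral_lower => //.
    + by apply: L2_integrable => //; exact: L2_cst.
    + by apply/measurable_EFinP; exact: measurable_funS mkx.
    apply: (@filterS _ _ _ _ _ _ (filterI kxE (filterI f_ge k1_le))).
    move=> x [kxx [fx k1x]] /NOf Ofx.
    rewrite lee_fin kxx// ler_pM ?(ltW c_gt0) ?(ltW eta_gt0)//; first exact: fx.
    by have := k1x Ofx; lra.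
  rewrite kxN [X in (X <= _)%E -> _](_ : _ = (c * eta)%:E * leb N)%E; last first.
    by rewrite -integral_cst.
  by rewrite pmule_rle0// lte_fin.
have := negligibleU (negligibleU nD N0) (negligibleU f_ge (negligibleU f_le k1_le)).
apply: negligibleS => x [Ox nGx] /=.
have [Dx|nDx] := pselect (D x); last by left; left; split.
have [Nx|nNx] := pselect (N x); first by left; right.
have [fc|?] := pselect (c <= f x); last by right; left=> /(_ Ox).
have [fM|?] := pselect (`|f x| <= M); last by right; right; left=> /(_ Ox).
right; right; right=> /(_ Ox) k1x; apply: nGx; split=> //.
by apply: contrapT => nH; apply: nNx; split.
Qed.

Lemma ae_good_source : {ae leb, forall x, Of x -> good_source x}.
Proof.
have : leb.-negligible (Of `\` good_source).
  apply/negligibleP; [exact: measurableD|exact: good_source_full].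
by apply: negligibleS => x /= /not_implyP.
Qed.

Lemma ae_good_target : {ae leb, forall y, Og y -> good_target y}.
Proof.
have : leb.-negligible (Og `\` good_target).
  apply/negligibleP; [exact: measurableD|exact: good_target_full].
by apply: negligibleS => x /= /not_implyP.
Qed.

(** The good source is dense in the domain of grad Phi: an open set in the support of f meets
    every set of full measure, since otherwise f would vanish almost everywhere on it. *)
Lemma gradient_in_target x : D x -> Og (grad Phi x).
Proof.
move=> Dx; have [cPhi _ _ _ _] := Phi_sol.
apply: (gradient_closure cPhi cOg (G := good_source)) => //.
- by move=> y [].
- by move=> y [_ _ _ _ []].
move=> U xU; have [xA _] := Dx.
have /nbhs_interior xW : nbhs x (U `&` Of) by apply: filterI.
apply: contrapT => UG0; have Ofx := interior_subset xA.
have /(_ (U `&` Of)°) := Ofx; apply.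
  by split; [exact: open_interior|exact: nbhs_singleton].
apply: filterS ae_good_source => y Gy /interior_subset[Uy Ofy].
by exfalso; apply: UG0; exists y; split=> //; exact: Gy.
Qed.

Definition source_density (x : E) : R := ((fun x => f x * (1 - k1 x)) \_ good_source) x.
Definition target_density (y : E) : R := ((fun y => g y * (1 - k2 y)) \_ good_target) y.

Let one_sub_gt0 (k : R) : k <= 1 - eta -> 0 < 1 - k.
Proof. by move=> kle; rewrite subr_gt0 (le_lt_trans kle)// gtrBl. Qed.

Lemma source_density_ge0 x : 0 <= source_density x.
Proof.
rewrite /source_density patchE; case: ifPn => // /set_mem[_ fc _ k1x _].
by apply: mulr_ge0; [exact: le_trans (ltW c_gt0) _|exact/ltW/one_sub_gt0].
Qed.

Lemma target_density_ge0 y : 0 <= target_density y.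
Proof.
rewrite /target_density patchE; case: ifPn => // /set_mem[_ gc _ k2y].
by apply: mulr_ge0; [exact: le_trans (ltW c_gt0) _|exact/ltW/one_sub_gt0].
Qed.

Let GOf : good_source `<=` Of. Proof. by move=> x [/DOf]. Qed.
Let HOg : good_target `<=` Og. Proof. by move=> x []. Qed.

Lemma measurable_source_density : measurable_fun setT source_density.
Proof.
apply/(measurable_restrictT _ mG); apply: measurable_funM.
  exact: measurable_funTS.
by apply: measurable_funB => //; exact: measurable_funS mk1.
Qed.

Lemma measurable_target_density : measurable_fun setT target_density.
Proof.
apply/(measurable_restrictT _ mH); apply: measurable_funM.
  exact: measurable_funTS.
by apply: measurable_funB => //; exact: measurable_funS mk2.
Qed.

Local Notation total_grad := (total_grad Of Phi).

Let mtotal : measurable_fun setT total_grad. Proof. exact: measurable_total_grad. Qed.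

Let integral_source S : measurable S ->
  (\int[leb]_(x in total_grad @^-1` S) (source_density x)%:E =
   \int[leb]_(x in D `&` grad Phi @^-1` S) (kx x)%:E)%E.
Proof.
move=> mS; have mN : measurable (D `&` grad Phi @^-1` S) by exact: mgrad.
rewrite [LHS]integral_mkcond [RHS]integral_mkcond.
have mpre : measurable (total_grad @^-1` S).
  by rewrite -[X in measurable X]setTI; exact: mtotal.
apply: ae_eq_integral => //.
- apply/(measurable_restrictT _ mpre); apply: measurable_funTS.
  by apply/measurable_EFinP; exact: measurable_source_density.
- apply/(measurable_restrictT _ mN)/measurable_EFinP.
  by apply: measurable_funS mkx => // x [/DOf].
apply: (@filterS _ _ _ _ _ _ (filterI ae_good_source kxE)) => x [/= nGx kxx] _.
rewrite !patchE; have [Gx|nG'x] := pselect (good_source x).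
  have [Dx _ _ _ _] := Gx; rewrite /source_density patchE (mem_set Gx).
  rewrite -(kxx (DOf Dx)).
  have -> // : (x \in total_grad @^-1` S) = (x \in D `&` grad Phi @^-1` S).
  apply/idP/idP; rewrite !inE /=; first by rewrite total_gradE.
  by move=> [_]; rewrite total_gradE.
rewrite /source_density patchE (memNset nG'x) if_same.
case: ifPn => // /set_mem [Dx _]; exfalso.
exact/nG'x/nGx/DOf.
Qed.

Let integral_target S : measurable S ->
  (\int[leb]_(y in S) (target_density y)%:E =
   \int[leb]_(y in Og `&` S) (ky y)%:E)%E.
Proof.
move=> mS; have mN : measurable (Og `&` S) by exact: measurableI.
rewrite [LHS]integral_mkcond [RHS]integral_mkcond.
apply: ae_eq_integral => //.
- apply/(measurable_restrictT _ mS); apply: measurable_funTS.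
  by apply/measurable_EFinP; exact: measurable_target_density.
- apply/(measurable_restrictT _ mN)/measurable_EFinP.
  by apply: measurable_funS mky => // x [].
apply: (@filterS _ _ _ _ _ _ (filterI ae_good_target kyE)) => y [/= nHy kyy] _.
rewrite !patchE; have [Hy|nH'y] := pselect (good_target y).
  have [Ogy _ _ _] := Hy; rewrite /target_density patchE (mem_set Hy) -(kyy Ogy).
  have -> // : (y \in S) = (y \in Og `&` S).
  by apply/idP/idP; rewrite !inE //= => -[].
rewrite /target_density patchE (memNset nH'y) if_same.
case: ifPn => // /set_mem [Oy _]; exfalso.
exact/nH'y/nHy.
Qed.

Lemma integrable_source_density : (\int[leb]_x (source_density x)%:E < +oo)%E.
Proof.
have io : leb.-integrable Of (fun x => (f x * (1 - k1 x))%:E).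
  apply: L2_integrable => //; apply: (L2_bddM mOf (measurable_funTS mf) f_le).
  by apply: L2B => //; exact: L2_cst.
have /(integrable_mkcond _ mG) := integrableS mOf mG GOf io.
move=> /integrableP[_]; apply: le_lt_trans; rewrite le_eqVlt; apply/orP; left.
apply/eqP; apply: eq_integral => x _; have := source_density_ge0 x.
rewrite /source_density !patchE; case: ifPn => // _ h; last by rewrite abse0.
by rewrite gee0_abs ?lee_fin.
Qed.

(** The push-forward identity, given for sets, says that the same measure is the image of the
    source density under grad Phi and the measure with the target density. *)
Lemma gradient_change_of_variables (psi : E -> \bar R) :
  measurable_fun setT psi -> (forall y, (0 <= psi y)%E) ->
  (\int[leb]_x (psi (total_grad x) * (source_density x)%:E) =
   \int[leb]_y (psi y * (target_density y)%:E))%E.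
Proof.
move=> mpsi psi0; have [_ _ _ _ push] := Phi_sol.
have [nu nuE] := exists_transported_measure measurable_source_density
  source_density_ge0 mtotal integrable_source_density.
rewrite -(ge0_integral_transported measurable_source_density source_density_ge0
  mtotal nuE)//.
apply: (ge0_integral_transported (h := id) measurable_target_density target_density_ge0) => //.
by move=> S mS; apply: etrans (nuE S mS) _; rewrite integral_source// push// -integral_target.
Qed.

(** The source density is bounded below by c eta, so the integral is controlled by that of
    |k2| against the target density, which is finite because both are square integrable. *)
Lemma integrable_k2_gradient :
  leb.-integrable good_source (fun x => (k2 (grad Phi x))%:E).
Proof.
have ceta : 0 < c * eta by rewrite mulr_gt0.
have mGrad : measurable_fun good_source (grad Phi).
  by apply: measurable_funS mgrad => // x [].
have mkappa : measurable_fun good_source (fun x => k2 (grad Phi x)).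
  apply: (@measurable_comp _ _ _ _ _ _ Og) => //.
  by move=> _ [x [_ _ _ _ [Oy _ _ _]] <-].
pose psi := (fun y => `|k2 y|%:E) \_ good_target.
have mpsi : measurable_fun setT psi.
  apply/(measurable_restrictT _ mH); apply/measurable_EFinP.
  by apply: measurableT_comp => //; exact: measurable_funS mk2.
have psi0 y : (0 <= psi y)%E by rewrite /psi patchE; case: ifP; rewrite ?lee_fin.
have v2 : L2 leb Og (fun y => g y * (1 - k2 y)).
  apply: (L2_bddM mOg (measurable_funTS mg) g_le).
  by apply: L2B => //; exact: L2_cst.
have fin : (\int[leb]_x (psi (total_grad x) * (source_density x)%:E) < +oo)%E.
  rewrite gradient_change_of_variables//.
  have /(integrable_mkcond _ mH)/integrableP[_] := integrableS mOg mH HOg (L2M mOg v2 k2_L2).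
  apply: le_lt_trans; rewrite le_eqVlt; apply/orP; left; apply/eqP.
  apply: eq_integral => y _; rewrite /psi /target_density !patchE.
  case: ifPn => [/set_mem [Oy gc _ k2y]|_]; last by rewrite mul0e abse0.
  rewrite -EFinM/= normrM mulrC; congr (_ * _)%:E; rewrite ger0_norm//.
  by apply: mulr_ge0; [exact: le_trans (ltW c_gt0) _|exact/ltW/one_sub_gt0].
apply/integrableP; split; first exact/measurable_EFinP.
(* On the good source 1 <= (c eta)^-1 f (1 - k1). *)
apply: (@le_lt_trans _ _ (\int[leb]_x ((c * eta)^-1%:E *
    (psi (total_grad x) * (source_density x)%:E)))%E).
  rewrite integral_mkcond; apply: ge0_le_integral => //.
  - by move=> x _; rewrite patchE; case: ifP.
  - apply/(measurable_restrictT _ mG); apply: measurableT_comp => //.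
    exact/measurable_EFinP.
  - apply: emeasurable_funM => //; apply: emeasurable_funM.
      exact: measurableT_comp mpsi mtotal.
    by apply/measurable_EFinP; exact: measurable_source_density.
  - move=> x _; rewrite patchE; case: ifPn => [/set_mem Gx|_]; last first.
      rewrite !mule_ge0// lee_fin ?invr_ge0 ?(ltW ceta)//.
      exact: source_density_ge0.
    have [Dx fc _ k1x Hx] := Gx.
    rewrite /psi /source_density !patchE (mem_set Gx) total_gradE// (mem_set Hx).
    rewrite -!EFinM lee_fin mulrCA ler_peMr// mulrC ler_pdivlMr// mul1r.
    by rewrite ler_pM ?(ltW c_gt0) ?(ltW eta_gt0)//; lra.
rewrite ge0_integralZl//.
- by rewrite lte_mul_pinfty ?lee_fin ?invr_ge0 ?(ltW ceta).
- apply: emeasurable_funM; first exact: measurableT_comp mpsi mtotal.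
  by apply/measurable_EFinP; exact: measurable_source_density.
- by move=> x _; rewrite mule_ge0// lee_fin source_density_ge0.
- by rewrite lee_fin invr_ge0 (ltW ceta).
Qed.

Let ae_restrict (h : E -> R) (P : set E) : {ae leb, forall x, esupp h x -> P x} ->
  P `<=` esupp h -> {ae leb, forall x, (h \_ P) x = h x}.
Proof.
move=> aeP Ph; apply: filterS2 (ae_esuppC h) aeP => x hx Px.
rewrite patchE; case: ifPn => // /negP; rewrite inE => nPx.
by rewrite hx// => /Px.
Qed.

Let integral_restrict (h : E -> R) (P S : set E) :
  measurable_fun setT h -> measurable P -> measurable S ->
  {ae leb, forall x, esupp h x -> P x} -> P `<=` esupp h ->
  (\int[leb]_(x in S) ((h \_ P) x)%:E = \int[leb]_(x in S) (h x)%:E)%E.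
Proof.
move=> mh mP mS aeP Ph; apply: ae_eq_integral => //.
- apply: measurable_funTS; apply/measurable_EFinP/(measurable_restrictT _ mP).
  exact: measurable_funTS.
- by apply: measurable_funTS; exact/measurable_EFinP.
- by apply: filterS (ae_restrict aeP Ph) => x hx _; rewrite hx.
Qed.

Variable T : R.
Hypothesis T_gt0 : 0 < T.

Lemma flow_start S : measurable S ->
  (\int[leb]_(x in transport_map T Phi Of 0 @^-1` S)
     (flow_mass T f k1 k2 Phi good_source 0 x)%:E =
   \int[leb]_(x in S) (f x)%:E)%E.
Proof.
move=> mS; rewrite -(integral_restrict mf mG mS ae_good_source GOf).
rewrite (_ : transport_map T Phi Of 0 @^-1` S = S); last first.
  rewrite (_ : transport_map T Phi Of 0 = id)//.
  apply/funext => x; rewrite /transport_map subr0 mul0r scale0r addr0.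
  by rewrite divff ?gt_eqF// scale1r.
apply: eq_integral => x _; rewrite /flow_mass !patchE; case: ifP => // _.
by rewrite /flow_density !mul0r subr0 mulr1 divr1.
Qed.

(** At t = T the mass is the source density divided by 1 - k2 o grad Phi; after the change of
    variables the factor 1 - k2 of the target density cancels. *)
Lemma flow_end S : measurable S ->
  (\int[leb]_(x in transport_map T Phi Of T @^-1` S)
     (flow_mass T f k1 k2 Phi good_source T x)%:E =
   \int[leb]_(y in S) (g y)%:E)%E.
Proof.
move=> mS; rewrite -(integral_restrict mg mH mS ae_good_target HOg).
rewrite (_ : transport_map T Phi Of T @^-1` S = total_grad @^-1` S); last first.
  rewrite (_ : transport_map T Phi Of T = total_grad)//.
  apply/funext => x; rewrite /transport_map subrr mul0r scale0r add0r.
  by rewrite divff ?gt_eqF// scale1r.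
pose psi := (fun y => ((1 - k2 y)^-1)%:E) \_ (good_target `&` S).
have mHS : measurable (good_target `&` S) by exact: measurableI.
have mpsi : measurable_fun setT psi.
  apply/(measurable_restrictT _ mHS); apply/measurable_EFinP.
  apply: (measurableT_comp (@measurable_invr R)); apply: measurable_funB => //.
  by apply: measurable_funS mk2 => // y [[]].
have psi0 y : (0 <= psi y)%E.
  rewrite /psi patchE; case: ifPn => // /set_mem [[_ _ _ k2y] _].
  by rewrite lee_fin invr_ge0 ltW// one_sub_gt0.
transitivity (\int[leb]_x (psi (total_grad x) * (source_density x)%:E))%E.
  rewrite integral_mkcond; apply: eq_integral => x _.
  rewrite /psi /source_density /flow_mass !patchE.
  have [Gx|nGx] := pselect (good_source x); last first.
    by rewrite (memNset nGx) mule0; case: ifP.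
  have [Dx _ _ _ Hx] := Gx; rewrite (mem_set Gx) total_gradE//.
  have -> : (x \in total_grad @^-1` S) = (grad Phi x \in good_target `&` S).
    by apply/idP/idP; rewrite !inE /= total_gradE// => -[].
  case: ifP => _; last by rewrite mul0e.
  by rewrite /flow_density divff ?gt_eqF// !mul1r -EFinM mulrC.
rewrite gradient_change_of_variables// [RHS]integral_mkcond.
apply: eq_integral => y _; rewrite /psi /target_density !patchE.
have [Hy|nHy] := pselect (good_target y); last first.
  by rewrite (memNset nHy) mule0; case: ifP.
have [_ _ _ k2y] := Hy; rewrite (mem_set Hy).
have -> : (y \in good_target `&` S) = (y \in S).
  by apply/idP/idP; rewrite !inE //= => -[].
case: ifP => _; last by rewrite mul0e.
by rewrite -EFinM mulrC mulfK// gt_eqF// one_sub_gt0.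
Qed.

End good_set.


(** * Consequences of the hypotheses on the data *)

Section hypotheses.
Context {R : realType} {d : nat}.
Local Notation E := 'rV[R]_d.
Local Notation leb := (@lebesgue_rV R d).
Implicit Types f g : E -> R.

(** The norm is 0 by convention when the whole space is null, a case treated apart. *)
Lemma finite_norm_ae_bounded f : finite_norm leb +oo%E f ->
  exists M, {ae leb, forall x, `|f x| <= M}.
Proof.
rewrite /finite_norm unlock /=; case: ifPn => [_ fin|leb0 _].
  have [M fM] := @ess_supr_bounded _ _ _ leb (fun x => `|f x|) fin.
  by exists M; apply: filterS fM => x.
exists 0; exists setT; split=> //; apply/eqP.
by rewrite eq_le measure_ge0 andbT leNgt.
Qed.

Lemma volume_gt0 f : esupp f !=set0 -> compact (esupp f) ->
  0 < volume (esupp f).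
Proof.
move=> f0 cf; apply: fine_gt0; rewrite compact_rV_lty// andbT.
by apply: esupp_leb_gt0 => //; exact: compact_rV_measurable.
Qed.

(** The bound in the dual class is 1 - delta |supp g| / f, with f bounded above by M; the
    maximum with c only ensures that the denominator is positive. *)
Lemma dual_class_gap f g h (delta M c : R) : 0 < c -> 0 < delta -> 0 < volume (esupp g) ->
  {ae leb, forall x, esupp f x -> c <= f x} ->
  {ae leb, forall x, esupp f x -> `|f x| <= M} ->
  dual_class delta f g h ->
  {ae leb, forall x, esupp f x -> h x <= 1 - delta * volume (esupp g) / Num.max c M}.
Proof.
move=> c0 d0 v0 fc fM [_ hle].
apply: (@filterS _ _ _ _ _ _ (filterI fc (filterI fM hle))).
move=> x [fcx [fMx hx]] Ox; apply: le_trans (hx Ox) _.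
have fx0 : 0 < f x by exact: lt_le_trans (fcx Ox).
rewrite lerD2l lerN2; apply: ler_wpM2l; first by rewrite mulr_ge0 ?(ltW d0) ?(ltW v0).
rewrite lef_pV2 ?posrE ?lt_max ?c0//.
by rewrite le_max (le_trans (ler_norm (f x)) (fMx Ox)) orbT.
Qed.

End hypotheses.

(** * Existence of the flow *)

Unset Implicit Arguments.

Theorem proposition7 (R : realType) (d : nat) (c delta T : R)
    (f g : 'rV[R]_d -> R) (C k : 'rV[R]_d * 'rV[R]_d -> R)
    (k1 k2 Phi : 'rV[R]_d -> R)
    (c_gt0 : 0 < c) (delta_gt0 : 0 < delta) (T_gt0 : 0 < T)
    (C_ge0 : forall z, 0 <= C z)
    (A1 : Minfty c f /\ Minfty c g)
    (A2 : convex_C11_domain (esupp f) /\ convex_C11_domain (esupp g))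
    (A3 : delta * Num.max (volume (esupp f)) (volume (esupp g)) <= c)
    (A4 : locally_holder C)
    (k_min : minimizer
       (L2ge (@lebesgue_rV R d \x @lebesgue_rV R d)%E (esupp f `*` esupp g) delta)
       (primal C f g) k)
    (k1_class : dual_class delta f g k1)
    (k2_class : dual_class delta g f k2)
    (k12_min : minimizer
       (L2 (@lebesgue_rV R d) (esupp f) `*` L2 (@lebesgue_rV R d) (esupp g))
       (dual delta C f g) (k1, k2))
    (Phi_sol : brenier_mccann (esupp f) (esupp g)
       (marginal_x g k) (marginal_y f k) Phi) :
  exists mu : R -> {finite_measure set 'rV[R]_d -> \bar R},
    [/\ continuity_equation T (interpolation_image T (esupp f) Phi)
          (velocity T (esupp f) Phi) (growth T (esupp f) Phi k1 k2) mu,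
        has_density (mu 0) f & has_density (mu T) g].
Proof.
have [[mf /finite_norm_ae_bounded[Mf fMf] cOf f_ge]
      [mg /finite_norm_ae_bounded[Mg gMg] cOg g_ge]] := A1.
have [[f0 _ _] [g0 _ _]] := A2.
pose M := Num.max c (Num.max Mf Mg).
have M0 : 0 < M by rewrite lt_max c_gt0.
have f_le : {ae @lebesgue_rV R d, forall x, esupp f x -> `|f x| <= M}.
  by apply: filterS fMf => x fx _; rewrite (le_trans fx)// !le_max lexx orbT.
have g_le : {ae @lebesgue_rV R d, forall x, esupp g x -> `|g x| <= M}.
  by apply: filterS gMg => x gx _; rewrite (le_trans gx)// !le_max lexx !orbT.
have vf := volume_gt0 f0 cOf; have vg := volume_gt0 g0 cOg.
have k1_gap := dual_class_gap c_gt0 delta_gt0 vg f_ge f_le k1_class.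
have k2_gap := dual_class_gap c_gt0 delta_gt0 vf g_ge g_le k2_class.
have cM : Num.max c M = M by apply/max_idPr; rewrite le_max lexx.
rewrite cM in k1_gap k2_gap.
pose eta := Num.min 1 (Num.min (delta * volume (esupp g) / M)
                               (delta * volume (esupp f) / M)).
have eta0 : 0 < eta by rewrite !lt_min ltr01 !divr_gt0 ?mulr_gt0.
have eta1 : eta <= 1 by rewrite ge_min lexx.
have k1_le : {ae @lebesgue_rV R d, forall x, esupp f x -> k1 x <= 1 - eta}.
  apply: filterS k1_gap => x h /h; move=> /le_trans; apply.
  by rewrite lerD2l lerN2 !ge_min lexx orbT.
have k2_le : {ae @lebesgue_rV R d, forall x, esupp g x -> k2 x <= 1 - eta}.
  apply: filterS k2_gap => x h /h; move=> /le_trans; apply.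
  by rewrite lerD2l lerN2 !ge_min lexx !orbT.
have C2 := continuous_prod_L2 (locally_holder_continuous A4) cOf cOg.
have kxE := minimizer_marginal_x c_gt0 mf mg cOf cOg f_ge g_ge f_le g_le C2
  k1_class k2_class k12_min k_min.
have kyE := minimizer_marginal_y c_gt0 mf mg cOf cOg f_ge g_ge f_le g_le C2
  k1_class k2_class k12_min k_min.
have mOf := compact_rV_measurable cOf; have mOg := compact_rV_measurable cOg.
have Ofoo := compact_rV_lty cOf; have Ogoo := compact_rV_lty cOg.
have Omoo : ((@lebesgue_rV R d \x @lebesgue_rV R d)%E (esupp f `*` esupp g) < +oo)%E.
  by rewrite product_measure1E// lte_mul_pinfty ?ge0_fin_numE.
have ik := L2_integrable (measurableX mOf mOg) Omoo (proj1 (proj1 k_min)).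
have mkx := measurable_marginal1 mOf mOg ik.
have mky := measurable_marginal2 mOf mOg ik.
have k1_L2 := proj1 k1_class; have k2_L2 := proj1 k2_class.
have [cPhi _ mD mgrad _] := Phi_sol.
pose G := good_source c M eta f g k1 k2 Phi.
have mG : measurable G.
  exact: measurable_good_source mf mg cOf cOg k1_L2 k2_L2 Phi_sol.
have GD : G `<=` grad_domain (esupp f) Phi by move=> x [].
have DOf : grad_domain (esupp f) Phi `<=` esupp f.
  by move=> x [Ax _]; exact: interior_subset.
have GOf : G `<=` esupp f by move=> x /GD/DOf.
have Goo : (@lebesgue_rV R d G < +oo)%E.
  by apply: le_lt_trans Ofoo; apply: le_measure; rewrite ?inE.
have mk1 : measurable_fun (grad_domain (esupp f) Phi) k1.
  by have /(L2P _ mOf)[mk1 _] := k1_L2; exact: measurable_funS mk1.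
have grad_in := gradient_in_target c_gt0 eta0 mf mg cOf cOg f_ge g_ge f_le g_le
  k1_L2 k2_L2 k1_le k2_le kxE mkx mky Phi_sol.
have mkappa : measurable_fun (grad_domain (esupp f) Phi) (fun x => k2 (grad Phi x)).
  apply: (@measurable_comp _ _ _ _ _ _ (esupp g)) => //.
    by move=> _ [x Dx <-]; exact: grad_in.
  by have /(L2P _ mOg)[] := k2_L2.
have f_bnd x : G x -> 0 <= f x <= M.
  move=> [_ fc fM _ _]; rewrite (le_trans (ltW c_gt0) fc)/=.
  exact: le_trans (ler_norm _) fM.
have G_k1 x : G x -> k1 x <= 1 - eta by move=> [].
have G_k2 x : G x -> k2 (grad Phi x) <= 1 - eta by move=> [_ _ _ _ []].
have [rf [_ rfP]] := compact_bounded cOf; have [rg [_ rgP]] := compact_bounded cOg.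
pose rho := Num.max rf rg + 1.
have x_bnd x : G x -> `|x| <= rho.
  by move=> /GOf; apply: rfP; rewrite /rho ltr_pwDr// le_max lexx.
have grad_bnd x : G x -> `|grad Phi x| <= rho.
  by move=> /GD/grad_in; apply: rgP; rewrite /rho ltr_pwDr// le_max lexx orbT.
have ik1 : (@lebesgue_rV R d).-integrable G (EFin \o k1).
  by apply: (integrableS mOf mG GOf); exact: L2_integrable.
have ikappa : (@lebesgue_rV R d).-integrable G (fun x => (k2 (grad Phi x))%:E).
  exact: (integrable_k2_gradient c_gt0 eta0 mf mg cOf cOg f_ge g_ge f_le g_le
    k1_L2 k2_L2 k1_le k2_le kxE kyE mkx mky Phi_sol).
(* Outside [0, T] the time is clamped, so a measure is chosen for every real t. *)
have /choice[mu muE] t := exists_flow_measure T_gt0 eta0 eta1 mD mgrad mG GD Goo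
  mf mk1 mkappa f_bnd G_k1 G_k2 ik1 (clamp_itv T_gt0 t).
exists mu; split.
- exact: (flow_solves_continuity_equation T_gt0 eta0 eta1 mD mgrad cPhi mG GD Goo
    mf mk1 mkappa f_bnd G_k1 G_k2 x_bnd grad_bnd ik1 ikappa muE).
- move=> S mS; rewrite muE// clamp_id ?lexx ?ltW//.
  exact: (flow_start c_gt0 eta0 mf mg cOf cOg f_ge g_ge f_le g_le
    k1_L2 k2_L2 k1_le k2_le kxE mkx mky Phi_sol).
- move=> S mS; rewrite muE// clamp_id ?lexx ?ltW//.
  exact: (flow_end c_gt0 eta0 mf mg cOf cOg f_ge g_ge f_le g_le
    k1_L2 k2_L2 k1_le k2_le kxE kyE mkx mky Phi_sol).
Qed.
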